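(* Let $(W,S)$ be a Coxeter system with $S\neq\emptyset$ and length function $\ell$, let $k$ be a field of characteristic $\ne2$, and let $B$ be the Artin-Tits group associated to $(W,S)$ (with its standard generators identified with $S$). The formulas $$s.E_w=\begin{cases}E_{sw}&\text{if }\ell(sw)=\ell(w)+1,\\ -2a^{\ell(w)}C+2aE_w-E_{sw}&\text{otherwise,}\end{cases}\qquad s.C=aC,$$ for all $s\in S$, $w\in W$, define a representation of $B$ on the free module over $k[a]/(a^2-1)$ with basis $C$ and the $E_w$, $w\in W$. When $W$ is finite, the image of the group algebra $(k[a]/(a^2-1))B$ in the endomorphism algebra of this representation is a free module of rank $1+|W|$. In all cases, this image projects onto the Iwahori-Hecke algebra of $(W,S)$ defined by the relations $(s-a)^2=0$ for all $s\in S$, with kernel the linear span of $\tilde C=-(s-a)^2$ for an arbitrary choice of $s\in S$. When $W$ admits a single conjugacy class of reflections, this algebra (the image) is the quotient of the group algebra of $B$ by the relations $(t-a)(s-a)^2=(s-a)^2(t-a)=0$ for all $s,t\in S$.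
   Context: Group algebras and linear spans are over $k[a]/(a^2-1)$. The Iwahori-Hecke algebra defined by $(s-a)^2=0$ is the quotient of $(k[a]/(a^2-1))B$ by the relations $(s-a)^2=0$, $s\in S$. The reflections of $W$ are the conjugates of elements of $S$. *)

(* Defs.v *)
From HB Require Import structures.
From mathcomp Require Import all_boot all_order all_algebra.
From mathcomp Require Import generic_quotient finmap monalg.
From mathcomp Require Import boolp classical_sets functions.

Set Implicit Arguments.
Unset Strict Implicit.
Unset Printing Implicit Defensive.

Import GRing.Theory.

Local Open Scope quotient_scope.
Local Open Scope ring_scope.

Section PresentedGroup.
Variable I : choiceType.

(* [(i, true)] stands for the generator i, [(i, false)] for its inverse. *)
Definition word : Type := seq (I * bool).
HB.instance Definition _ := Choice.on word.

Variable rels : word -> word -> Prop.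

Inductive word_equiv : word -> word -> Prop :=
| WordRefl u : word_equiv u u
| WordSym u v of word_equiv u v : word_equiv v u
| WordTrans u v w of word_equiv u v & word_equiv v w : word_equiv u w
| WordCat u u' v v' of word_equiv u u' & word_equiv v v' :
    word_equiv (u ++ v) (u' ++ v')
| WordCancel i b : word_equiv [:: (i, b); (i, ~~ b)] [::]
| WordRel u v of rels u v : word_equiv u v.

Definition word_eqb : rel word := fun u v => `[< word_equiv u v >].

Lemma word_eqb_equiv : equiv_class_of word_eqb.
Proof.
split=> [u|u v|v u w].
- by apply/asboolP; exact: WordRefl.
- by apply/asboolP/asboolP => h; exact: WordSym.
- by move=> /asboolP huv /asboolP hvw; apply/asboolP; exact: WordTrans huv hvw.
Qed.
Canonical word_eqb_rel := EquivRelPack word_eqb_equiv.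
Canonical word_eqb_encModRel := defaultEncModRel word_eqb.

Definition presented_group : Type := {eq_quot word_eqb}.
HB.instance Definition _ : EqQuotient word word_eqb presented_group :=
  EqQuotient.on presented_group.
HB.instance Definition _ := Choice.on presented_group.

Lemma pres_eqP (u v : word) :
  reflect (word_equiv u v) (u == v %[mod presented_group]).
Proof. by rewrite piE; exact: asboolP. Qed.

Definition word_inv (u : word) : word := rev [seq (x.1, ~~ x.2) | x <- u].

Lemma word_invK : involutive word_inv.
Proof.
move=> u; rewrite /word_inv map_rev revK -map_comp -[RHS]map_id.
by apply: eq_map => -[i b] /=; rewrite negbK.
Qed.

Lemma word_invr u : word_equiv (u ++ word_inv u) [::].
Proof.
elim: u => [|[i b] u IHu]; first exact: WordRefl.
rewrite /word_inv /= rev_cons -cats1 catA -cat1s.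
apply: WordTrans (WordCancel i b).
apply: (@WordCat [:: (i, b)] [:: (i, b)] _ [:: (i, ~~ b)]).
  exact: WordRefl.
rewrite -[X in word_equiv _ X]cat0s; apply: WordCat => //; exact: WordRefl.
Qed.

Lemma word_invl u : word_equiv (word_inv u ++ u) [::].
Proof. by have := word_invr (word_inv u); rewrite word_invK. Qed.

Lemma word_inv_equiv u v : word_equiv u v ->
  word_equiv (word_inv u) (word_inv v).
Proof.
move=> huv; have hl : word_equiv (word_inv u) (word_inv u ++ (v ++ word_inv v)).
  rewrite -{1}[word_inv u]cats0; apply: WordCat; first exact: WordRefl.
  exact/WordSym/word_invr.
apply: WordTrans hl _; rewrite catA -[X in word_equiv _ X]cat0s.
apply: WordCat; last exact: WordRefl.
apply: WordTrans (word_invl u); apply: WordCat; first exact: WordRefl.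
exact: WordSym.
Qed.

Definition pres_one : presented_group := \pi_presented_group [::].
Definition pres_mul (x y : presented_group) : presented_group :=
  \pi_presented_group (repr x ++ repr y).
Definition pres_inv (x : presented_group) : presented_group :=
  \pi_presented_group (word_inv (repr x)).

Lemma repr_word_equiv (u : word) :
  word_equiv (repr (\pi_presented_group u)) u.
Proof. by apply/pres_eqP; rewrite reprK. Qed.

Lemma pres_mulE (u v : word) :
  pres_mul (\pi_presented_group u) (\pi_presented_group v) = \pi_presented_group (u ++ v).
Proof. by apply/eqP/pres_eqP/WordCat; exact: repr_word_equiv. Qed.

Lemma pres_invE (u : word) :
  pres_inv (\pi_presented_group u) = \pi_presented_group (word_inv u).
Proof. by apply/eqP/pres_eqP/word_inv_equiv; exact: repr_word_equiv. Qed.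

Lemma pres_mulA : associative pres_mul.
Proof.
elim/quotW=> u; elim/quotW=> v; elim/quotW=> w.
by rewrite (pres_mulE v w) (pres_mulE u v) !pres_mulE catA.
Qed.

Lemma pres_mul1 : left_id pres_one pres_mul.
Proof. by elim/quotW=> u; rewrite pres_mulE. Qed.

Lemma pres_mulr1 : right_id pres_one pres_mul.
Proof. by elim/quotW=> u; rewrite pres_mulE cats0. Qed.

Lemma pres_mulV : left_inverse pres_one pres_inv pres_mul.
Proof.
elim/quotW=> u; rewrite pres_invE pres_mulE.
exact/eqP/pres_eqP/word_invl.
Qed.

Lemma pres_mulrV : right_inverse pres_one pres_inv pres_mul.
Proof.
elim/quotW=> u; rewrite pres_invE pres_mulE.
exact/eqP/pres_eqP/word_invr.
Qed.

HB.instance Definition _ := isGroup.Build presented_group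
  pres_mulA pres_mul1 pres_mulr1 pres_mulV pres_mulrV.

Definition pres_gen (i : I) : presented_group := \pi_presented_group [:: (i, true)].

End PresentedGroup.

Section CoxeterSystem.
Variables (W : groupType) (S : {pred W}).

Definition gens : Type := {s : W | s \in S}.
HB.instance Definition _ := Choice.on gens.

Definition has_order (g : W) (n : nat) : Prop :=
  (0 < n)%N /\ forall m, ((g ^+ m)%g == 1%g) = (n %| m)%N.

Definition coxeter_rels (u v : word gens) : Prop :=
  exists (s t : gens) (m : nat),
    [/\ has_order (val s * val t)%g m,
        u = flatten (nseq m [:: (s, true); (t, true)]) & v = [::]].

(* Bourbaki's definition: S consists of elements of order 2 and W is presented *)
(* by S with the relations (st)^m = 1 for s, t in S with st of finite order m. *)
Definition coxeter_system : Prop :=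
  (forall s, s \in S -> has_order s 2) /\
  exists phi : {multiplicative presented_group coxeter_rels -> W},
    bijective phi /\ forall s : gens, phi (pres_gen coxeter_rels s) = val s.

Definition alternating (s t : gens) (m : nat) : word gens :=
  mkseq (fun i => (if odd i then t else s, true)) m.

Definition braid_rels (u v : word gens) : Prop :=
  exists (s t : gens) (m : nat),
    [/\ has_order (val s * val t)%g m,
        u = alternating s t m & v = alternating t s m].

Definition artin_group : Type := presented_group braid_rels.
HB.instance Definition _ := Group.on artin_group.

Definition artin_gen (s : gens) : artin_group := pres_gen braid_rels s.

Definition expressible (w : W) (n : nat) : Prop :=
  exists u : seq gens, size u = n /\ (\prod_(s <- u) val s)%g = w.

(* The length is 0 by convention on elements not generated by S. *)
Definition cox_length (w : W) : nat :=
  match pselect (exists n, `[< expressible w n >]) with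
  | left ex => ex_minn ex
  | right _ => 0%N
  end.

Definition reflection (r : W) : Prop :=
  exists (s : gens) (w : W), r = (w * val s * w^-1)%g.

Definition single_reflection_class : Prop :=
  forall r r' : W, reflection r -> reflection r' ->
    exists w : W, r' = (w * r * w^-1)%g.

End CoxeterSystem.

Section GroupAlgebra.
Variables (R : comNzRingType) (G : groupType).

Definition grpalg : Type := {malg R[G]}.
HB.instance Definition _ := GRing.Lmodule.copy grpalg {malg R[G]}.

Implicit Types x y z : grpalg.

Definition grpalg_of (g : G) : grpalg := << g >>.
Definition grpalg_one : grpalg := grpalg_of 1%g.
Definition grpalg_mul x y : grpalg :=
  \sum_(g <- msupp x) \sum_(h <- msupp y) << x@_g * y@_h *g (g * h)%g >>.

Definition grpalg_ext (M : lmodType R) (f : G -> M) x : M :=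
  \sum_(g <- msupp x) x@_g *: f g.

Lemma grpalg_extEw (M : lmodType R) (f : G -> M) x (d : {fset G}) :
  (msupp x `<=` d)%fset -> grpalg_ext f x = \sum_(g <- d) x@_g *: f g.
Proof.
move=> xd; apply: big_fset_incl => // g _ gx.
by rewrite (mcoeff_outdom gx) scale0r.
Qed.

Lemma grpalg_ext_linear (M : lmodType R) (f : G -> M) : linear (grpalg_ext f).
Proof.
move=> c x y; pose d := (msupp x `|` msupp y `|` msupp (c *: x + y))%fset.
rewrite !(@grpalg_extEw _ _ _ d) ?fsubsetUr //; last 2 first.
- by rewrite /d -fsetUA fsetUCA fsubsetUl.
- by rewrite /d -fsetUA fsubsetUl.
rewrite scaler_sumr -big_split /=; apply: eq_bigr => g _.
by rewrite mcoeffD mcoeffZ scalerDl scalerA.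
Qed.
HB.instance Definition _ (M : lmodType R) (f : G -> M) :=
  GRing.isLinear.Build R grpalg M _ (grpalg_ext f) (grpalg_ext_linear f).

Lemma grpalg_extU (M : lmodType R) (f : G -> M) (g : G) :
  grpalg_ext f (grpalg_of g) = f g.
Proof.
rewrite (@grpalg_extEw _ _ _ [fset g]%fset) ?msuppU_le //.
by rewrite big_seq_fset1 mcoeffUU scale1r.
Qed.

Lemma grpalg_ind (P : grpalg -> Prop) :
  P 0 -> (forall c g x, P x -> P (c *: grpalg_of g + x)) -> forall x, P x.
Proof.
move=> P0 PD x; rewrite [x]monalgE.
elim: (enum_fset (msupp x)) => [|g s IHs]; first by rewrite big_nil.
rewrite big_cons; have -> : << x@_g *g g >> = x@_g *: grpalg_of g.
  by apply/malgP => h; rewrite mcoeffZ !mcoeffU mulr_natr.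
exact: PD.
Qed.

Lemma grpalg_mulE x y :
  grpalg_mul x y =
  grpalg_ext (fun g => grpalg_ext (fun h => grpalg_of (g * h)%g) y) x.
Proof.
apply: eq_bigr => g _; rewrite scaler_sumr; apply: eq_bigr => h _.
by apply/malgP => l; rewrite !mcoeffZ !mcoeffU mulrA mulr_natr.
Qed.

Lemma grpalg_mulDl : left_distributive grpalg_mul +%R.
Proof. by move=> x y z; rewrite !grpalg_mulE linearD. Qed.

Lemma grpalg_mulZl c x y : grpalg_mul (c *: x) y = c *: grpalg_mul x y.
Proof. by rewrite !grpalg_mulE linearZ. Qed.

Lemma grpalg_mulDr : right_distributive grpalg_mul +%R.
Proof.
move=> x y z; rewrite !grpalg_mulE -big_split /=.
by apply: eq_bigr => g _; rewrite linearD scalerDr.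
Qed.

Lemma grpalg_mulZr c x y : grpalg_mul x (c *: y) = c *: grpalg_mul x y.
Proof.
rewrite !grpalg_mulE scaler_sumr; apply: eq_bigr => g _.
by rewrite linearZ /= !scalerA mulrC.
Qed.

Lemma grpalg_mulU (g h : G) :
  grpalg_mul (grpalg_of g) (grpalg_of h) = grpalg_of (g * h)%g.
Proof. by rewrite grpalg_mulE !grpalg_extU. Qed.

Lemma grpalg_mul0l x : grpalg_mul 0 x = 0.
Proof. by rewrite grpalg_mulE linear0. Qed.

Lemma grpalg_mul0r x : grpalg_mul x 0 = 0.
Proof. by have := grpalg_mulZr 0 x 0; rewrite !scale0r. Qed.

Lemma grpalg_mul1l : left_id grpalg_one grpalg_mul.
Proof.
elim/grpalg_ind => [|c g x IHx]; first exact: grpalg_mul0r.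
by rewrite grpalg_mulDr grpalg_mulZr grpalg_mulU mul1g IHx.
Qed.

Lemma grpalg_mul1r : right_id grpalg_one grpalg_mul.
Proof.
elim/grpalg_ind => [|c g x IHx]; first exact: grpalg_mul0l.
by rewrite grpalg_mulDl grpalg_mulZl grpalg_mulU mulg1 IHx.
Qed.

Lemma grpalg_mulA : associative grpalg_mul.
Proof.
pose mul := grpalg_mul; rewrite -/mul.
have mulDl : left_distributive mul +%R := grpalg_mulDl.
have mulDr : right_distributive mul +%R := grpalg_mulDr.
have mulZl c x y : mul (c *: x) y = c *: mul x y := grpalg_mulZl c x y.
have mulZr c x y : mul x (c *: y) = c *: mul x y := grpalg_mulZr c x y.
have mul0l x : mul 0 x = 0 := grpalg_mul0l x.
have mul0r x : mul x 0 = 0 := grpalg_mul0r x.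
have mulU g h : mul (grpalg_of g) (grpalg_of h) = grpalg_of (g * h)%g.
  exact: grpalg_mulU.
move: mul mulDl mulDr mulZl mulZr mul0l mul0r mulU.
move: grpalg_of grpalg_ind => U ind mul mulDl mulDr mulZl mulZr mul0l mul0r mulU.
move=> x y z; elim/ind: x => [|c g x IHx]; first by rewrite !mul0l.
rewrite !(mulDl, mulZl) {}IHx; apply: (congr1 (fun t => c *: t + _)).
elim/ind: y => [|d h y IHy]; first by rewrite mul0l mul0r mul0l.
rewrite !(mulDl, mulDr, mulZl, mulZr) {}IHy; apply: (congr1 (fun t => d *: t + _)).
elim/ind: z => [|e l z IHz]; first by rewrite !mul0r.
rewrite !(mulDr, mulZr) IHz; apply: (congr1 (fun t => e *: t + _)).
by rewrite !mulU mulgA.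
Qed.

HB.instance Definition _ := GRing.Zmodule_isPzRing.Build grpalg
  grpalg_mulA grpalg_mul1l grpalg_mul1r grpalg_mulDl grpalg_mulDr.

Lemma grpalg_ofM (g h : G) : grpalg_of (g * h)%g = grpalg_of g * grpalg_of h.
Proof. by rewrite -grpalg_mulU. Qed.

Lemma grpalg_of1 : grpalg_of 1%g = 1. Proof. by []. Qed.

Lemma grpalg_scalerAl c x y : c *: (x * y) = (c *: x) * y.
Proof. by symmetry; exact: grpalg_mulZl. Qed.

Lemma grpalg_scalerAr c x y : c *: (x * y) = x * (c *: y).
Proof. by symmetry; exact: grpalg_mulZr. Qed.

(* Stability under scalars follows from [IdealM], see [grpalg_idealZ]. *)
Inductive grpalg_ideal (X : grpalg -> Prop) : grpalg -> Prop :=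
| IdealGen x of X x : grpalg_ideal X x
| Ideal0 : grpalg_ideal X 0
| IdealD x y of grpalg_ideal X x & grpalg_ideal X y : grpalg_ideal X (x + y)
| IdealM x y z of grpalg_ideal X y : grpalg_ideal X (x * y * z).

Section Quotient.
Variable X : grpalg -> Prop.
Local Notation J := (grpalg_ideal X).

Lemma grpalg_idealZ c x : J x -> J (c *: x).
Proof.
by move=> Jx; rewrite -[x]mul1r grpalg_scalerAl -[_ * x]mulr1; exact: IdealM.
Qed.

Lemma grpalg_idealMl x y : J y -> J (x * y).
Proof. by move=> Jy; rewrite -[_ * _]mulr1; exact: IdealM. Qed.

Lemma grpalg_idealMr x y : J x -> J (x * y).
Proof. by move=> Jx; rewrite -[x]mul1r; exact: IdealM. Qed.

Lemma grpalg_idealN x : J x -> J (- x).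
Proof. by rewrite -scaleN1r; exact: grpalg_idealZ. Qed.

Definition grpalg_ideal_pred : pred grpalg := fun x => `[< J x >].

Lemma grpalg_ideal_zmod_closed : zmod_closed grpalg_ideal_pred.
Proof.
split=> [|x y /asboolP Jx /asboolP Jy]; apply/asboolP; first exact: Ideal0.
by apply: IdealD => //; exact: grpalg_idealN.
Qed.
HB.instance Definition _ := GRing.isZmodClosed.Build grpalg grpalg_ideal_pred
  grpalg_ideal_zmod_closed.
Definition grpalg_ideal_closed : zmodClosed grpalg :=
  GRing.ZmodClosed.clone grpalg grpalg_ideal_pred _.

(* The algebra presented as the quotient of R G by the relations x = 0, X x. *)
Definition grpalg_quot : Type := Quotient.quot grpalg_ideal_closed.
HB.instance Definition _ := GRing.Zmodule.on grpalg_quot.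

Definition grpalg_proj (x : grpalg) : grpalg_quot :=
  \pi_(Quotient.quot grpalg_ideal_closed) x.
Definition grpalg_repr (x : grpalg_quot) : grpalg :=
  repr (x : Quotient.quot grpalg_ideal_closed).

Lemma grpalg_reprK (x : grpalg_quot) : grpalg_proj (grpalg_repr x) = x.
Proof. exact: reprK. Qed.

Lemma grpalg_projP x y : grpalg_proj x = grpalg_proj y <-> J (x - y).
Proof.
have e := Quotient.idealrBE grpalg_ideal_closed x y.
split=> [exy|Jxy]; first by apply/asboolP; move/eqP: exy; rewrite -e.
by apply/eqP; rewrite -e; exact/asboolP.
Qed.

Lemma grpalg_projB : zmod_morphism grpalg_proj.
Proof. by move=> x y; rewrite /grpalg_proj !piE. Qed.
HB.instance Definition _ :=
  GRing.isZmodMorphism.Build grpalg grpalg_quot grpalg_proj grpalg_projB.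

Lemma repr_proj x : J (grpalg_repr (grpalg_proj x) - x).
Proof. by apply/grpalg_projP; rewrite grpalg_reprK. Qed.

Definition grpalg_quot_mul (x y : grpalg_quot) : grpalg_quot :=
  grpalg_proj (grpalg_repr x * grpalg_repr y).
Definition grpalg_quot_scale (c : R) (x : grpalg_quot) : grpalg_quot :=
  grpalg_proj (c *: grpalg_repr x).

Lemma grpalg_quot_mulE x y :
  grpalg_quot_mul (grpalg_proj x) (grpalg_proj y) = grpalg_proj (x * y).
Proof.
apply/grpalg_projP; set x' := grpalg_repr _; set y' := grpalg_repr _.
rewrite -(subrKA (x' * y)) -mulrBr -mulrBl; apply: IdealD.
  exact/grpalg_idealMl/repr_proj.
exact/grpalg_idealMr/repr_proj.
Qed.

Lemma grpalg_quot_scaleE c x :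
  grpalg_quot_scale c (grpalg_proj x) = grpalg_proj (c *: x).
Proof.
by apply/grpalg_projP; rewrite -scalerBr; apply/grpalg_idealZ/repr_proj.
Qed.

Lemma grpalg_quotP (P : grpalg_quot -> Prop) :
  (forall x, P (grpalg_proj x)) -> forall q, P q.
Proof. by move=> h q; rewrite -[q]grpalg_reprK. Qed.

Lemma grpalg_projD x y :
  grpalg_proj x + grpalg_proj y = grpalg_proj (x + y).
Proof. by rewrite raddfD. Qed.

Let qE := (grpalg_quot_mulE, grpalg_quot_scaleE, grpalg_projD).

Lemma grpalg_quot_mulA : associative grpalg_quot_mul.
Proof.
elim/grpalg_quotP=> x; elim/grpalg_quotP=> y; elim/grpalg_quotP=> z.
by rewrite !qE mulrA.
Qed.

Lemma grpalg_quot_mul1 : left_id (grpalg_proj 1) grpalg_quot_mul.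
Proof. by elim/grpalg_quotP=> x; rewrite !qE mul1r. Qed.

Lemma grpalg_quot_mulr1 : right_id (grpalg_proj 1) grpalg_quot_mul.
Proof. by elim/grpalg_quotP=> x; rewrite !qE mulr1. Qed.

Lemma grpalg_quot_mulDl : left_distributive grpalg_quot_mul +%R.
Proof.
elim/grpalg_quotP=> x; elim/grpalg_quotP=> y; elim/grpalg_quotP=> z.
by rewrite !qE mulrDl.
Qed.

Lemma grpalg_quot_mulDr : right_distributive grpalg_quot_mul +%R.
Proof.
elim/grpalg_quotP=> x; elim/grpalg_quotP=> y; elim/grpalg_quotP=> z.
by rewrite !qE mulrDr.
Qed.

HB.instance Definition _ := GRing.Zmodule_isPzRing.Build grpalg_quot
  grpalg_quot_mulA grpalg_quot_mul1 grpalg_quot_mulr1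
  grpalg_quot_mulDl grpalg_quot_mulDr.

Lemma grpalg_quot_scaleA c d (x : grpalg_quot) :
  grpalg_quot_scale c (grpalg_quot_scale d x) = grpalg_quot_scale (c * d) x.
Proof. by elim/grpalg_quotP: x => x; rewrite !qE scalerA. Qed.

Lemma grpalg_quot_scale1 : left_id 1 grpalg_quot_scale.
Proof. by elim/grpalg_quotP=> x; rewrite !qE scale1r. Qed.

Lemma grpalg_quot_scaleDr : right_distributive grpalg_quot_scale +%R.
Proof.
move=> c; elim/grpalg_quotP=> x; elim/grpalg_quotP=> y.
by rewrite !qE scalerDr.
Qed.

Lemma grpalg_quot_scaleDl (x : grpalg_quot) :
  {morph grpalg_quot_scale^~ x : c d / c + d}.
Proof.
by elim/grpalg_quotP: x => x c d; rewrite !qE scalerDl.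
Qed.

HB.instance Definition _ := GRing.Zmodule_isLmodule.Build R grpalg_quot
  grpalg_quot_scaleA grpalg_quot_scale1 grpalg_quot_scaleDr
  grpalg_quot_scaleDl.

Lemma grpalg_proj_monoid : monoid_morphism grpalg_proj.
Proof. by split=> // x y; rewrite -grpalg_quot_mulE. Qed.
HB.instance Definition _ := GRing.isMonoidMorphism.Build grpalg grpalg_quot
  grpalg_proj grpalg_proj_monoid.

Lemma grpalg_proj_scalable : scalable grpalg_proj.
Proof. by move=> c x; rewrite -grpalg_quot_scaleE. Qed.
HB.instance Definition _ := GRing.isScalable.Build R grpalg grpalg_quot _
  grpalg_proj grpalg_proj_scalable.

End Quotient.
End GroupAlgebra.

Section Endomorphisms.
Variables (R : comNzRingType) (V : lmodType R).

Definition endo_pred : pred (V -> V) := fun f => `[< linear f >].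

Record endo : Type := Endo { endo_fun :> V -> V; _ : endo_pred endo_fun }.
HB.instance Definition _ := [isSub for endo_fun].
HB.instance Definition _ := [Choice of endo by <:].

Lemma endo_is_linear (f : endo) : linear f.
Proof. by case: f => f /= /asboolP. Qed.
HB.instance Definition _ (f : endo) :=
  GRing.isLinear.Build R V V _ (endo_fun f) (endo_is_linear f).

Lemma endo_submod_closed : submod_closed endo_pred.
Proof.
split=> [|c f g /asboolP hf /asboolP hg]; apply/asboolP => d x y /=.
  by rewrite -[LHS]/(0 : V) -[RHS]/(d *: (0 : V) + 0) scaler0 addr0.
rewrite -[LHS]/(c *: f (d *: x + y) + g (d *: x + y)).
rewrite -[RHS]/(d *: (c *: f x + g x) + (c *: f y + g y)).
by rewrite hf hg !scalerDr !scalerA mulrC addrACA.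
Qed.
HB.instance Definition _ := GRing.isSubmodClosed.Build R (V -> V) endo_pred
  endo_submod_closed.
HB.instance Definition _ := [SubChoice_isSubLmodule of endo by <:].

Lemma endoP (f g : endo) : f =1 g <-> f = g.
Proof. by split=> [/funext h|->//]; exact: val_inj. Qed.

Lemma endoDE (f g : endo) v : (f + g) v = f v + g v. Proof. by []. Qed.
Lemma endoZE c (f : endo) v : (c *: f) v = c *: f v. Proof. by []. Qed.

Lemma endo_id_proof : endo_pred id. Proof. exact/asboolP. Qed.
Definition endo_one : endo := Endo endo_id_proof.

Lemma endo_comp_proof (f g : endo) : endo_pred (f \o g).
Proof. by apply/asboolP => c x y /=; rewrite !linearP. Qed.
Definition endo_mul (f g : endo) : endo := Endo (endo_comp_proof f g).

Lemma endo_mulA : associative endo_mul.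
Proof. by move=> f g h; apply/endoP. Qed.
Lemma endo_mul1 : left_id endo_one endo_mul.
Proof. by move=> f; apply/endoP. Qed.
Lemma endo_mulr1 : right_id endo_one endo_mul.
Proof. by move=> f; apply/endoP. Qed.
Lemma endo_mulDl : left_distributive endo_mul +%R.
Proof. by move=> f g h; apply/endoP. Qed.
Lemma endo_mulDr : right_distributive endo_mul +%R.
Proof.
move=> f g h; apply/endoP => v.
by rewrite -[LHS]/(f (g v + h v)) linearD.
Qed.

HB.instance Definition _ := GRing.Zmodule_isPzRing.Build endo
  endo_mulA endo_mul1 endo_mulr1 endo_mulDl endo_mulDr.

Lemma endo1E v : (1 : endo) v = v. Proof. by []. Qed.
Lemma endoME (f g : endo) v : (f * g) v = f (g v). Proof. by []. Qed.

Lemma endo_scalerAl c (f g : endo) : c *: (f * g) = (c *: f) * g.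
Proof. by apply/endoP. Qed.
Lemma endo_scalerAr c (f g : endo) : c *: (f * g) = f * (c *: g).
Proof.
apply/endoP => v.
by rewrite -[LHS]/(c *: f (g v)) -[RHS]/(f (c *: g v)) linearZ.
Qed.

End Endomorphisms.

Section Representations.
Variables (R : comNzRingType) (G : groupType) (V : lmodType R).

Record representation : Type := Representation {
  rep_fun :> G -> endo V;
  rep1 : rep_fun 1%g = 1;
  repM : forall g h, rep_fun (g * h)%g = rep_fun g * rep_fun h
}.

Variable rho : representation.

Definition rep_alg (x : grpalg R G) : endo V := grpalg_ext rho x.
HB.instance Definition _ := GRing.isLinear.Build R (grpalg R G) (endo V) _
  rep_alg (grpalg_ext_linear rho).

Lemma rep_algU g : rep_alg (grpalg_of R g) = rho g.
Proof. exact: grpalg_extU. Qed.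

Lemma rep_alg_monoid : monoid_morphism rep_alg.
Proof.
split=> [|x y]; first by rewrite -grpalg_of1 rep_algU rep1.
have D u v : rep_alg (u + v) = rep_alg u + rep_alg v by exact: linearD.
have Z c u : rep_alg (c *: u) = c *: rep_alg u by exact: linearZ.
have N : rep_alg 0 = 0 by exact: linear0.
elim/grpalg_ind: x => [|c g x IHx]; first by rewrite mul0r N mul0r.
rewrite mulrDl D IHx D mulrDl; congr (_ + _).
rewrite -grpalg_scalerAl !Z rep_algU.
apply: (@etrans _ _ (c *: (rho g * rep_alg y))); last exact: endo_scalerAl.
congr (_ *: _); elim/grpalg_ind: y {IHx} => [|d h y IHy].
  by rewrite mulr0 N mulr0.
rewrite mulrDr D IHy D mulrDr; congr (_ + _).
rewrite -grpalg_scalerAr !Z -grpalg_ofM !rep_algU repM.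
exact: endo_scalerAr.
Qed.
HB.instance Definition _ := GRing.isMonoidMorphism.Build
  (grpalg R G) (endo V) rep_alg rep_alg_monoid.

Definition image_pred : pred (endo V) :=
  fun f => `[< exists x, f = rep_alg x >].

Record image_alg : Type := ImageAlg {
  image_val :> endo V; _ : image_pred image_val }.
HB.instance Definition _ := [isSub for image_val].
HB.instance Definition _ := [Choice of image_alg by <:].

Lemma image_subring_closed : subring_closed image_pred.
Proof.
split=> [|_ _ /asboolP[x ->] /asboolP[y ->]|_ _ /asboolP[x ->] /asboolP[y ->]];
  apply/asboolP.
- by exists 1; rewrite rmorph1.
- by exists (x - y); rewrite rmorphB.
- by exists (x * y); rewrite rmorphM.
Qed.
Lemma image_submod_closed : submod_closed image_pred.
Proof.
split=> [|c _ _ /asboolP[x ->] /asboolP[y ->]]; apply/asboolP.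
  by exists 0; rewrite linear0.
by exists (c *: x + y); rewrite linearP.
Qed.
HB.instance Definition _ := GRing.isSubringClosed.Build (endo V) image_pred
  image_subring_closed.
HB.instance Definition _ := GRing.isSubmodClosed.Build R (endo V) image_pred
  image_submod_closed.
HB.instance Definition _ := [SubChoice_isSubLmodule of image_alg by <:].
HB.instance Definition _ := GRing.SubZmodule_isSubPzRing.Build
  (endo V) image_pred image_alg image_subring_closed.

Lemma to_image_proof x : image_pred (rep_alg x).
Proof. by apply/asboolP; exists x. Qed.
Definition to_image (x : grpalg R G) : image_alg := ImageAlg (to_image_proof x).

Lemma to_image_monoid : monoid_morphism to_image.
Proof.
by split=> [|x y]; apply: val_inj; [exact: rmorph1 | exact: rmorphM].
Qed.
Lemma to_image_linear : linear to_image.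
Proof. by move=> c x y; apply: val_inj; exact: linearP. Qed.
HB.instance Definition _ := GRing.isLinear.Build R (grpalg R G) image_alg _
  to_image to_image_linear.
HB.instance Definition _ := GRing.isMonoidMorphism.Build
  (grpalg R G) image_alg to_image to_image_monoid.

End Representations.

Definition free_of_rank (R : comNzRingType) (M : lmodType R) (n : nat) : Prop :=
  exists f : {linear 'rV[R]_n -> M}, bijective f.

Section HeckeExtension.
Variable k : fieldType.

Definition base_ring : comNzRingType := {poly %/ ('X^2 - 1 : {poly k})}.
Definition base_a : base_ring := 'qX.

Variables (W : groupType) (S : {pred W}).

Local Notation artin_alg := (grpalg base_ring (artin_group S)).

(* MathComp has no algebra structure on possibly trivial rings, so the scalar *)
(* a is embedded in the group algebra as a *: 1.                              *)
Definition sub_a (s : gens S) : artin_alg :=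
  grpalg_of base_ring (artin_gen s) - base_a *: (1 : artin_alg).

Definition hecke_rels (x : artin_alg) : Prop := exists s, x = sub_a s ^+ 2.
Definition cubic_rels (x : artin_alg) : Prop :=
  exists s t, x = sub_a t * sub_a s ^+ 2 \/ x = sub_a s ^+ 2 * sub_a t.

Definition Ctilde (s : gens S) : artin_alg := - sub_a s ^+ 2.

(* The basis is indexed by [None] (for C) and [Some w] (for E_w). *)
Definition ext_module : lmodType base_ring := {malg base_ring[option W]}.
Definition basisC : ext_module := << None >>.
Definition basisE (w : W) : ext_module := << Some w >>.

Definition ext_formulas
    (rho : representation (artin_group S) ext_module) : Prop :=
  forall s : gens S,
    rho (artin_gen s) basisC = base_a *: basisC /\
    forall w : W, let sw := (val s * w)%g in let l := cox_length S in
      rho (artin_gen s) (basisE w) =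
        if l sw == (l w).+1 then basisE sw
        else - (2%:R * base_a ^+ l w) *: basisC
             + (2%:R * base_a) *: basisE w - basisE sw.

End HeckeExtension.

(* Main.v *)
(** Let P_s be the operators of the statement, and let Q_s be their mirror
    images, which multiply the indices w by s on the right.  The exchange
    condition shows that every P_s commutes with every Q_t.  As the Q_t generate
    the whole module from E_1, an operator that commutes with them is determined
    by its value at E_1: this gives the braid relations, and shows that
    evaluation at E_1 identifies the image of the group algebra with the module.
    In particular -(s-a)^2 sends E_w to 2a^(l(w)+1) C and kills C, whence it
    does not depend on s, and multiplying it by s on either side amounts to
    multiplying it by a.

    Conversely, let the group algebra act on a module M in such a way that
    -(s-a)^2 acts as an operator c independent of s with sc = cs = ac.  By
    Matsumoto's theorem every w has a well defined lift T_w in the Artin group,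
    and for m in M the map sending E_w to T_w m and C to (a/2) c m commutes with
    the actions.  So the kernel of the evaluation at E_1 annihilates M.  This is
    applied to the regular modules of the two quotients of the group algebra; in
    the cubic one the squares (s-a)^2 agree because ws = tw with l(ws) > l(w)
    implies T_w s = t T_w, which makes conjugate simple reflections s and t have
    conjugate lifts. *)
Require Import Defs.
From HB Require Import structures.
From mathcomp Require Import all_boot all_order all_algebra.
From mathcomp Require Import finmap monalg boolp qpoly zify ring.

Set Implicit Arguments.
Unset Strict Implicit.
Unset Printing Implicit Defensive.

Import GRing.Theory.
Local Open Scope ring_scope.

(** * Coxeter groups *)

Section PresentedGroup.
Variables (I : choiceType) (rels : word I -> word I -> Prop).
Local Notation pi := (\pi_(presented_group rels))%qT.

Lemma pi_cat u v : pi (u ++ v) = (pi u * pi v)%g.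
Proof. by symmetry; exact: pres_mulE. Qed.

Lemma pi_nil : pi [::] = 1%g.
Proof. by []. Qed.

Lemma pi_inv_gen i : pi [:: (i, false)] = (pres_gen rels i)^-1%g.
Proof. by symmetry; exact: pres_invE. Qed.
End PresentedGroup.

Section Coxeter.
Variables (W : groupType) (S : {pred W}) (coxS : coxeter_system S).
Implicit Types (s t q r : gens S) (u v x y : seq (gens S)) (w : W) (n m : nat).

Local Notation prodw u := (\prod_(s <- u) val s)%g.
Local Notation len := (cox_length S).

(** The braid word [s t s ...] without the signs of [alternating], so that it can be evaluated in
    any monoid. *)
Definition alt s t n : seq (gens S) := mkseq (fun i => if odd i then t else s) n.

Lemma altS s t n : alt s t n.+1 = s :: alt t s n.
Proof.
rewrite /alt /mkseq /= -[1%N]addn0 iotaDl -map_comp; congr cons.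
by apply: eq_map => i /=; case: (odd i).
Qed.

Lemma size_alt s t n : size (alt s t n) = n.
Proof. exact: size_mkseq. Qed.

Lemma take_alt s t m n : (m <= n)%N -> take m (alt s t n) = alt s t m.
Proof. by move=> mn; rewrite /alt /mkseq -map_take take_iota (minn_idPl mn). Qed.

Lemma prodw_cat u v : prodw (u ++ v) = (prodw u * prodw v)%g.
Proof. exact: big_cat. Qed.

Lemma prodw1 s : prodw [:: s] = val s.
Proof. exact: big_seq1. Qed.

Lemma gensK s : (val s * val s = 1)%g.
Proof.
have [_ /(_ 2)] := coxS.1 _ (valP s).
by rewrite dvdnn expg2 => /eqP.
Qed.

Lemma gensV s : (val s)^-1%g = val s.
Proof. exact: mulg1_eq (gensK s). Qed.

Lemma gensMK s : involutive (fun w => (val s * w)%g).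
Proof. by move=> w; rewrite mulgA gensK mul1g. Qed.

Lemma prodw_rev u : prodw (rev u) = (prodw u)^-1%g.
Proof.
rewrite -{2}[u]revK -prodgV; apply: eq_bigr => s _; exact/esym/gensV.
Qed.

Definition pos_word u : word (gens S) := [seq (s, true) | s <- u].

(** The isomorphism [phi] sends the class of a positive word to its product, and it is injective. *)
Lemma prodw_equiv u v : prodw u = prodw v ->
  word_equiv (@coxeter_rels W S) (pos_word u) (pos_word v).
Proof.
have [_ [phi [phi_bij phi_gen]]] := coxS.
have phi1 : phi 1%g = 1%g.
  by apply: (@mulgI _ (phi 1%g)); rewrite -gmulfM !mulg1.
have phiE z : phi (\pi_(presented_group (@coxeter_rels W S)) (pos_word z))%qT
    = prodw z.
  elim: z => [|s z IHz]; first by rewrite big_nil -[RHS]phi1.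
  rewrite big_cons -IHz -phi_gen -gmulfM; congr (phi _).
  by rewrite -pi_cat.
rewrite -!phiE => /(bij_inj phi_bij) /eqP; exact: pres_eqP.
Qed.

Lemma prodw_surj w : exists u, prodw u = w.
Proof.
have [_ [phi [[phi' _ phiK] phi_gen]]] := coxS.
have phi1 : phi 1%g = 1%g.
  by apply: (@mulgI _ (phi 1%g)); rewrite -gmulfM !mulg1.
rewrite -(phiK w); elim/quotW: (phi' w) => z; exists [seq i.1 | i <- z].
elim: z => [|[s b] z IHz]; first by rewrite big_nil -[LHS]phi1.
rewrite /= big_cons IHz.
rewrite -cat1s pi_cat gmulfM; congr (_ * _)%g.
case: b => /=; first by rewrite -phi_gen.
rewrite -gensV -phi_gen pi_inv_gen; apply: (mulgI (phi (pres_gen _ s))).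
by rewrite mulgV -gmulfM mulgV.
Qed.

(** Universal property of the Coxeter presentation, for actions on a bare type. A letter of either
    sign acts by [f s], which is its own inverse. *)
Lemma cox_action (T : Type) (f : gens S -> T -> T) :
    (forall s, involutive (f s)) ->
    (forall s t m, has_order (val s * val t)%g m ->
       forall z, iter m (fun z' => f t (f s z')) z = z) ->
  forall u v, prodw u = prodw v ->
    forall z, foldl (fun z' s => f s z') z u = foldl (fun z' s => f s z') z v.
Proof.
move=> fK f_rel u v /prodw_equiv uv.
pose F := foldl (fun (z' : T) (i : gens S * bool) => f i.1 z').
have FE z u' : foldl (fun z' s => f s z') z u' = F z (pos_word u').
  by elim: u' z => //= s u' IH z; rewrite IH.
move=> z; rewrite !FE; move: (pos_word u) (pos_word v) uv z => {FE}u' v'.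
rewrite /F; elim=> {u v u' v'} //.
- by move=> u v w _ + _ + z => -> ->.
- by move=> u u' v v' _ IHu _ IHv z; rewrite !foldl_cat IHu IHv.
- by move=> s b z /=; rewrite fK.
- move=> _ _ [s [t [m [st_m -> ->]]]] z /=; rewrite -[RHS](f_rel s t m st_m z).
  by elim: m z {st_m} => //= m IHm z; rewrite IHm -iterSr.
Qed.

Lemma odd_prodw u v : prodw u = prodw v -> odd (size u) = odd (size v).
Proof.
move=> uv.
have cnt z x : foldl (fun b (_ : gens S) => ~~ b) z x = z (+) odd (size x).
  by elim: x z => [|s x IHx] z /=; rewrite ?addbF // IHx addNb addbN.
(* Every generator acts on [bool] by negation, which respects the relations because the relators
   have even length. *)
have := @cox_action bool (fun _ b => ~~ b) _ _ u v uv false.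
rewrite !cnt; apply=> [_|_ _ m _ z]; first exact: negbK.
by elim: m => //= m ->; rewrite negbK.
Qed.

(** * Length and reduced words *)

Lemma len_min u : (len (prodw u) <= size u)%N.
Proof.
rewrite /cox_length; case: pselect => // ex.
by case: ex_minnP => n _; apply; apply/asboolP; exists u.
Qed.

Definition reduced u := size u == len (prodw u).

Lemma reduced_word w : exists u, reduced u /\ prodw u = w.
Proof.
have [u0 u0w] := prodw_surj w.
have [u [un uw]] : expressible S w (len w).
  rewrite /cox_length; case: pselect => [ex|[]].
    by case: ex_minnP => n /asboolP.
  by exists (size u0); apply/asboolP; exists u0.
by exists u; rewrite /reduced uw un.
Qed.

Lemma reduced_le u v : reduced u -> prodw u = prodw v -> (size u <= size v)%N.
Proof. by move=> /eqP -> ->; exact: len_min. Qed.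

Lemma le_reduced u v : reduced u -> prodw u = prodw v -> (size v <= size u)%N ->
  reduced v.
Proof.
move=> /eqP ru uv vu; rewrite /reduced eqn_leq len_min andbT.
by rewrite -uv -ru.
Qed.

Lemma len1 : len (1%g : W) = 0%N.
Proof. by apply/eqP; rewrite -leqn0; have := len_min [::]; rewrite big_nil. Qed.

(** A shorter word for the suffix would shorten the whole word. *)
Lemma reduced_catr u v : reduced (u ++ v) -> reduced v.
Proof.
move=> ruv; have [v' [rv' v'v]] := reduced_word (prodw v).
apply: (le_reduced rv' v'v); rewrite -(leq_add2l (size u)) -!size_cat.
by apply: reduced_le ruv _; rewrite !prodw_cat v'v.
Qed.

Lemma reduced_catl u v : reduced (u ++ v) -> reduced u.
Proof.
move=> ruv; have [u' [ru' u'u]] := reduced_word (prodw u).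
apply: (le_reduced ru' u'u); rewrite -(leq_add2r (size v)) -!size_cat.
by apply: reduced_le ruv _; rewrite !prodw_cat u'u.
Qed.

Lemma reduced_rev u : reduced u -> reduced (rev u).
Proof.
move=> ru; have [v [rv vu]] := reduced_word (prodw (rev u)).
apply: (le_reduced rv vu); rewrite size_rev -(size_rev v).
by apply: reduced_le ru _; rewrite prodw_rev vu prodw_rev invgK.
Qed.

Lemma lenV w : len w^-1%g = len w.
Proof.
have [u [ru <-]] := reduced_word w.
by rewrite -prodw_rev -(eqP (reduced_rev ru)) size_rev (eqP ru).
Qed.

Lemma len_le_mull s w : (len (val s * w)%g <= (len w).+1)%N.
Proof.
have [u [ru <-]] := reduced_word w.
by rewrite -(eqP ru); have := len_min (s :: u); rewrite big_cons.
Qed.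

(** The two lengths differ by at most one, and parity excludes equality. *)
Lemma len_mull s w :
  len (val s * w)%g = (len w).+1 \/ len w = (len (val s * w)%g).+1.
Proof.
have le1 := len_le_mull s w; have := len_le_mull s (val s * w)%g.
rewrite gensMK => le2.
have [u [ru uw]] := reduced_word w; have [v [rv vw]] := reduced_word (val s * w)%g.
have := @odd_prodw (s :: u) v; rewrite big_cons uw vw => /(_ erefl) /=.
move: ru rv le1 le2; rewrite /reduced uw vw => /eqP -> /eqP ->.
move=> le1 le2; case: (ltngtP (len (val s * w)%g) (len w)) => [lt|lt|->].
- by move=> _; right; apply/eqP; rewrite eqn_leq le2.
- by move=> _; left; apply/eqP; rewrite eqn_leq le1.
- by case: odd.
Qed.

Lemma len_mulr s w :
  len (w * val s)%g = (len w).+1 \/ len w = (len (w * val s)%g).+1.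
Proof.
by have := len_mull s w^-1%g; rewrite -(lenV (_ * _)%g) invgM invgK gensV lenV.
Qed.

Lemma reduced_cons s u : reduced u ->
  len (val s * prodw u)%g = (len (prodw u)).+1 -> reduced (s :: u).
Proof. by rewrite /reduced big_cons /= => /eqP -> ->. Qed.

(** Appending the reversal of [alt t s n] to [alt s t n] continues the alternation and gives
    [(st)^n]. Hence the two braid words have equal products exactly when [(st)^n = 1]. *)
Lemma prodw_alt s t n :
  prodw (alt s t n) = ((val s * val t) ^+ n * prodw (alt t s n))%g.
Proof.
elim: n s t => [|n IHn] s t; first by rewrite !big_nil mul1g.
rewrite !altS !big_cons (IHn t s) expgSr.
have e r q m : (val r * (val q * val r) ^+ m = (val r * val q) ^+ m * val r)%g.
  elim: m => [|m IHm]; first by rewrite mulg1 mul1g.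
  by rewrite expgSr mulgA IHm expgSr !mulgA.
by rewrite mulgA e !mulgA -[(_ * val s * val t * val t)%g]mulgA gensK mulg1.
Qed.

(* Running these steps along a word counts modulo 2 the occurrences of a given *)
(* reflection in its sequence of reflections (Bourbaki, Lie IV, 1.4).          *)
Definition refl_step s (z : W * bool) : W * bool :=
  ((val s * z.1 * val s)%g, z.2 (+) (z.1 == val s)).

Lemma refl_stepK s : involutive (refl_step s).
Proof.
move=> [r b]; rewrite /refl_step /= -!mulgA gensK mulg1 gensMK; congr pair.
have -> : (val s * (r * val s) == val s)%g = (r == val s).
  by rewrite -[X in _ == X]mulg1 (inj_eq (mulgI _)) mulg_eq1 gensV.
by rewrite addbK.
Qed.

Lemma refl_step_rel s t m : has_order (val s * val t)%g m ->
  forall z, iter m (fun z' => refl_step t (refl_step s z')) z = z.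
Proof.
case=> m0 ord_m; pose d := (val s * val t)%g.
have dm : (d ^+ m)%g = 1%g by apply/eqP; rewrite ord_m.
have dV : d^-1%g = (val t * val s)%g by rewrite invgM !gensV.
have ds i : (val s * d ^- i)%g = (d ^+ i * val s)%g.
  elim: i => [|i IHi]; first by rewrite invg1 mul1g mulg1.
  by rewrite {1}expgS invgM mulgA IHi -mulgA dV !mulgA expgSr /d !mulgA.
move=> [r b].
(* After [i] rounds the element has been conjugated by [d ^+ i], and the flag has been compared with
   the [2i] reflections [d ^+ j * val s]. *)
have iterE i : iter i (fun z' => refl_step t (refl_step s z')) (r, b) =
    ((d ^- i * r * d ^+ i)%g,
     b (+) \big[addb/false]_(0 <= j < i.*2) (r == (d ^+ j * val s)%g)).
  have conjE j (g : W) :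
      (d ^- j * r * d ^+ j == g)%g = (r == d ^+ j * g * d ^- j)%g.
    rewrite -{1}[g](mulgVK (d ^+ j)%g) (inj_eq (mulIg _)).
    by rewrite -(inj_eq (mulgI (d ^+ j)%g)) mulgA mulgV mul1g mulgA.
  elim: i => [|i IHi]; first by rewrite big_geq // addbF invg1 mul1g mulg1.
  rewrite iterS IHi doubleS !big_nat_recr //= /refl_step /= !addbA; congr pair.
    by rewrite expgSr invgM dV /d !mulgA.
  congr (_ (+) _ (+) _); first by rewrite conjE -mulgA ds mulgA -expgnDr addnn.
  rewrite -(inj_eq (mulgI (val s))) -(inj_eq (mulIg (val s))) -!mulgA gensK.
  rewrite mulg1 gensMK !mulgA conjE -!mulgA ds !mulgA -[(d ^+ i * _ * _)%g]mulgA -/d.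
  by rewrite -expgSr -expgnDr addSn addnn.
(* As [d ^+ m = 1], the second half of the range repeats the first and the flags cancel. *)
rewrite iterE dm invg1 mul1g mulg1 -addnn (big_cat_nat _ (leq_addr m m)) //=.
rewrite -{2}[m]add0n big_addn addnK.
rewrite [X in _ (+) (_ (+) X)](_ : _ = \big[addb/false]_(0 <= j < m) (r == d ^+ j * val s)%g).
  by rewrite addbb addbF.
by apply: eq_bigr => j _; rewrite expgnDr dm mulg1.
Qed.

Lemma refl_shift u w b : (foldl (fun z s => refl_step s z) (w, b) u).2 =
  b (+) (foldl (fun z s => refl_step s z) (w, false) u).2.
Proof.
elim: u w b => [|s u IHu] w b /=; first by rewrite addbF.
by rewrite /refl_step /= IHu [in RHS]IHu addbA.
Qed.

Lemma refl_occurs u w b : (foldl (fun z s => refl_step s z) (w, b) u).2 != b ->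
  exists v q x, u = v ++ q :: x /\ (w * prodw v = prodw v * val q)%g.
Proof.
elim: u w b => [|s u IHu] w b /=; first by rewrite eqxx.
rewrite /refl_step /=; have [-> _|ws] := eqVneq w (val s).
  by exists [::], s, u; rewrite big_nil mul1g mulg1.
rewrite addbF => /IHu[v [q [x [-> e]]]]; exists (s :: v), q, x; split=> //.
by rewrite big_cons -(gensMK s (w * _)%g) -[RHS]mulgA -e !mulgA.
Qed.

(** The parity [eta] with which the reflection [val s] occurs in a word depends only on the product
    of the word. It is even for a reduced word [v] of [s u], and prefixing [s] flips it, so [val s]
    occurs in [u]. *)
Lemma exchange s u : (len (val s * prodw u)%g < len (prodw u))%N ->
  exists v q x, u = v ++ q :: x /\ (val s * prodw v = prodw v * val q)%g.
Proof.
move=> lt_su; pose eta u := (foldl (fun z s => refl_step s z) (val s, false) u).2.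
have [v [rv vsu]] := reduced_word (val s * prodw u)%g.
(* An occurrence in [v] would let the prefixed [s] cancel a letter of [v], which makes a word for
   [prodw u] shorter than its length. *)
have eta_v : eta v = false.
  apply/negbTE/negP => ev.
  have [|y [q [x [vE e]]]] := @refl_occurs v (val s) false.
    by rewrite -/(eta v) ev.
  have uE : prodw u = prodw (y ++ x).
    rewrite -(gensMK s (prodw u)) -vsu vE !prodw_cat big_cons mulgA e.
    by rewrite -!mulgA gensMK.
  have := len_min (y ++ x); rewrite -uE leqNgt => /negP[].
  by apply: leq_trans lt_su; rewrite -vsu -(eqP rv) vE !size_cat /= addnS.
have foldE := cox_action refl_stepK refl_step_rel.
have eta_u : eta u = true.
  rewrite /eta (foldE _ (s :: v)); last by rewrite big_cons vsu gensMK.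
  rewrite /= {2}/refl_step /= eqxx refl_shift gensK mul1g.
  by rewrite -/(eta v) eta_v.
by apply: (@refl_occurs u (val s) false); rewrite -/(eta u) eta_u.
Qed.

(** When both products go up, the exchange condition is applied to a reduced word of [w] followed by
    [t]. The remaining case follows from this one for [s w]. *)
Lemma folding s t w : len (val s * w)%g = len (w * val t)%g ->
  len (val s * w * val t)%g = len w -> (val s * w = w * val t)%g.
Proof.
have up w' : len (val s * w')%g = (len w').+1 -> len (w' * val t)%g = (len w').+1 ->
    len (val s * w' * val t)%g = len w' -> (val s * w' = w' * val t)%g.
  move=> su tu stu; have [u [ru uw]] := reduced_word w'.
  have utE : prodw (rcons u t) = (w' * val t)%g.
    by rewrite -cats1 prodw_cat prodw1 uw.
  have [|v [q [x [uE e]]]] := @exchange s (rcons u t).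
    by rewrite utE mulgA stu tu.
  (* Either the final [t] is cancelled, which is the claim, or a letter of [u] is, which makes a
     word for [s w'] that is too short. *)
  case/lastP: x uE => [|x y]; first by rewrite cats1 => /rcons_inj[uv ->]; rewrite -uw uv e.
  rewrite -rcons_cons -rcons_cat => /rcons_inj[uE _].
  have := len_min (v ++ x).
  have -> : prodw (v ++ x) = (val s * w')%g.
    by rewrite -uw uE !prodw_cat big_cons !mulgA e -[(_ * val q * val q)%g]mulgA gensK mulg1.
  rewrite su -uw -(eqP ru) uE !size_cat /= addnS ltnNge.
  by move=> /negP; case; rewrite ltnW.
move=> st stw; case: (len_mull s w) => sw; first by apply: up => //; rewrite -st.
have e : (w = val s * w * val t)%g.
  by rewrite -{1}(gensMK s w); apply: up; rewrite ?gensMK ?stw -?st.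
by rewrite {2}e -!mulgA gensK mulg1.
Qed.

Lemma has_orderC s t m : has_order (val s * val t)%g m ->
  has_order (val t * val s)%g m.
Proof.
case=> m0 ord_m; split=> // j; rewrite -ord_m -invg_eq1 -expVgn.
by rewrite invgM !gensV.
Qed.

(** If prefixing [s] failed to lengthen the word, exchange would equate the two braid words of some
    length [k] with [0 < k < m], so that [(st)^k = 1], against the order [m]. *)
Lemma reduced_alt s t m n : has_order (val s * val t)%g m -> (n <= m)%N ->
  reduced (alt s t n).
Proof.
elim: n s t => [|n IHn] s t ord_m nm; first by rewrite /reduced big_nil len1.
have rn := IHn t s (has_orderC ord_m) (ltnW nm).
rewrite altS; apply: reduced_cons => //.
case: (len_mull s (prodw (alt t s n))) => // lt_s.
have [|v [q [x [vE e]]]] := @exchange s (alt t s n); first by rewrite lt_s.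
have vn : (size v < n)%N.
  by rewrite -(size_alt t s n) vE size_cat /= addnS ltnS leq_addr.
have v_alt : v ++ [:: q] = alt t s (size v).+1.
  by rewrite -(take_alt t s vn) vE take_cat ltnNge leqnSn /= subSn // subnn /= take0.
have v_alt' : v = alt t s (size v).
  by rewrite -(take_alt t s (ltnW vn)) vE take_size_cat.
have := prodw_alt s t (size v).+1.
rewrite altS -v_alt' big_cons -v_alt prodw_cat prodw1 e.
rewrite -{1}[(prodw v * val q)%g]mul1g => /mulIg /esym/eqP.
rewrite ord_m.2 => /dvdn_leq -/(_ isT).
by rewrite leqNgt (leq_trans _ nm).
Qed.

(** * Matsumoto's theorem *)

Section Matsumoto.
Variables (M : monoidType) (F : gens S -> M).
Hypothesis F_braid : forall s t m, has_order (val s * val t)%g m ->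
  (\prod_(q <- alt s t m) F q = \prod_(q <- alt t s m) F q)%g.

Local Notation prodF u := (\prod_(s <- u) F s)%g.

(** Equal products give [(st)^n = 1], so [st] has finite order [m <= n]; a reduced alternating word
    has at most [m] letters, which leaves the braid relation itself. *)
Lemma alt_eq_prodF s t n : reduced (alt s t n) ->
  prodw (alt s t n) = prodw (alt t s n) ->
  prodF (alt s t n) = prodF (alt t s n).
Proof.
case: n => // n red_n; rewrite prodw_alt -[RHS]mul1g => /mulIg st1.
have ex : exists m, (0 < m)%N && ((val s * val t) ^+ m == 1)%g.
  by exists n.+1; apply/eqP.
have [m /andP[m0 /eqP stm] m_min] := ex_minnP ex.
have ord_m : has_order (val s * val t)%g m.
  split=> // j; rewrite {1}(divn_eq j m) expgnDr mulnC expgnA stm expg1n mul1g.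
  rewrite /dvdn; have := ltn_pmod j m0; case: (j %% m)%N => [|r] lt_r.
    by rewrite expg0 !eqxx.
  apply/negbTE/negP => st_r; move: (m_min r.+1); rewrite st_r /= => /(_ isT).
  by rewrite leqNgt lt_r.
have : (m <= n.+1)%N by rewrite m_min // st1 eqxx.
rewrite leq_eqVlt => /orP[/eqP <-|lt_mn]; first exact: F_braid.
(* Otherwise the first [m + 1] letters are [s] followed by [alt t s m], which has the same product
   as [alt s t m]; the two leading [s] then cancel. *)
have := red_n; rewrite -(cat_take_drop m.+1 (alt s t n.+1)) take_alt //.
move=> /reduced_catl; rewrite altS => red_m.
have tE : prodw (alt t s m) = prodw (alt s t m).
  by rewrite (prodw_alt s) stm mul1g.
case: m lt_mn red_m tE {stm m_min ord_m} m0 => // m _ red_m tE _.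
have := reduced_le red_m (v := alt t s m).
rewrite big_cons tE altS big_cons gensMK => /(_ erefl).
by rewrite /= size_map size_iota ltnNge size_alt leqnSn.
Qed.

(** By induction on the length, two words that share their first or last letter have equal images. A
    counterexample can therefore be rotated by exchange until both of its words alternate between
    two generators, where [alt_eq_prodF] applies. *)
Lemma matsumoto u v : reduced u -> prodw u = prodw v -> size u = size v ->
  prodF u = prodF v.
Proof.
move: {2}(size u) (erefl (size u)) => n.
elim: n u v => [|n IHn] u v; first by case: u; case: v.
move=> un ru uv vn; apply: contrapT => F_ne.
have rv : reduced v by apply: le_reduced ru uv _; rewrite vn.
have cons_eq s x y : size x = n -> reduced (s :: x) -> reduced (s :: y) ->
    prodw (s :: x) = prodw (s :: y) -> prodF (s :: x) = prodF (s :: y).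
  move=> xn rx ry; rewrite !big_cons => /mulgI xy; congr (_ * _)%g.
  have rx' : reduced x := @reduced_catr [:: s] x rx.
  have ry' : reduced y := @reduced_catr [:: s] y ry.
  by apply: IHn => //; rewrite (eqP rx') xy (eqP ry').
have rcons_eq s x y : size x = n -> reduced (rcons x s) -> reduced (rcons y s) ->
    prodw (rcons x s) = prodw (rcons y s) -> prodF (rcons x s) = prodF (rcons y s).
  move=> xn; rewrite -!cats1 => rx ry.
  rewrite !big_cat !big_seq1 /= => /mulIg xy; congr (_ * _)%g.
  have rx' := reduced_catl rx; have ry' := reduced_catl ry.
  by apply: IHn => //; rewrite (eqP rx') xy (eqP ry').
(* Exchange moves [t] to the front of [x]. Were the deleted letter not the last of [x], the new word
   would share its first letter with [t :: y] and its last with [x], forcing equal images. *)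
have rotate x t y : reduced x -> reduced (t :: y) -> size x = n.+1 ->
    prodw x = prodw (t :: y) -> prodF x <> prodF (t :: y) ->
  exists x', [/\ reduced (t :: x'), prodw (t :: x') = prodw x,
    prodF (t :: x') <> prodF x & exists q, x = rcons x' q].
  move=> rx ry xn xy Fxy.
  have yn : size (t :: y) = n.+1 by rewrite (eqP ry) -xy -(eqP rx).
  have [|z1 [q [z2 [xE e]]]] := @exchange t x.
    rewrite -(eqP rx) xn xy big_cons gensMK ltnS.
    by case: yn => <-; exact: len_min.
  have zx : prodw (t :: z1 ++ z2) = prodw x.
    by rewrite xE big_cons !prodw_cat big_cons mulgA e -mulgA.
  have zn : size (t :: z1 ++ z2) = n.+1.
    by rewrite -xn xE /= !size_cat /= addnS.
  have rz : reduced (t :: z1 ++ z2).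
    by apply: (le_reduced rx) => //; rewrite zn xn.
  have Fzy : prodF (t :: z1 ++ z2) = prodF (t :: y).
    by apply: cons_eq => //; [case: zn | rewrite zx].
  exists (z1 ++ z2); split=> //; first by rewrite Fzy => /esym.
  case/lastP: z2 xE zx zn rz Fzy => [|z2 p] xE zx zn rz Fzy.
    by exists q; rewrite xE cats1 cats0.
  case: Fxy; rewrite -Fzy xE -rcons_cons -!rcons_cat -rcons_cons.
  apply: rcons_eq.
  - by move: xn; rewrite xE -rcons_cons -rcons_cat size_rcons => -[].
  - by rewrite rcons_cat rcons_cons -xE.
  - by rewrite -rcons_cat in rz.
  - by rewrite rcons_cons !rcons_cat rcons_cons -xE -zx.
(* Each rotation lengthens the alternating prefix by one letter and swaps [s] and [t]; the previous
   first word becomes the second word of the new pair. *)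
have altern i : (0 < i <= n.+1)%N -> exists s t x y,
    [/\ reduced (alt s t i ++ x), reduced (t :: y),
        size (alt s t i ++ x) = n.+1,
        prodw (alt s t i ++ x) = prodw (t :: y)
      & prodF (alt s t i ++ x) <> prodF (t :: y)].
  elim: i => // -[_ _|i IHi /andP[_ lt_i]].
    case: u v un ru uv vn F_ne rv => [|s x] [|t y] // un ru uv _ F_ne rv.
    by exists s, t, x, y.
  have [|s [t [x [y [rx ry xn xy Fxy]]]]] := IHi; first exact: ltnW.
  have [x' [rx' x'x Fx' [q xE]]] := rotate _ _ _ rx ry xn xy Fxy.
  case/lastP: x xE rx xn xy Fxy x'x Fx' => [|x p] xE rx xn xy Fxy x'x Fx'.
    by move: xn lt_i; rewrite cats0 size_alt => ->; rewrite ltnn.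
  move: xE; rewrite -rcons_cat => /rcons_inj[x'E _]; subst x'.
  exists t, s, x, (alt t s i ++ rcons x p).
  have -> : alt t s i.+2 ++ x = t :: (alt s t i.+1 ++ x) by rewrite altS.
  have -> : s :: (alt t s i ++ rcons x p) = alt s t i.+1 ++ rcons x p.
    by rewrite altS.
  by split=> //; rewrite -xn (eqP rx') x'x (eqP rx).
have [|s [t [x [y [rx ry xn xy Fxy]]]]] := altern n.+1; first by rewrite leqnn.
have [x' [rx' x'x Fx' [q xE]]] := rotate _ _ _ rx ry xn xy Fxy.
have x0 : x = [::].
  by apply: size0nil; move: xn; rewrite size_cat size_alt -[RHS]addn0 => /addnI.
move: xE x'x Fx' rx; rewrite x0 cats0 => xE.
have -> : t :: x' = alt t s n.+1.
  rewrite altS -(@take_alt s t n n.+1) // xE -cats1 take_cat.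
  by move: (congr1 size xE); rewrite size_alt size_rcons => -[->]; rewrite ltnn subnn cats0.
move=> x'x Fx' rx; apply: Fx'; apply/esym/alt_eq_prodF => //.
Qed.
End Matsumoto.
End Coxeter.

(** * Lifts to the Artin group *)

Section ArtinLift.
Variables (W : groupType) (S : {pred W}) (coxS : coxeter_system S).
Implicit Types (s t : gens S) (u v : seq (gens S)) (w : W).

Local Notation prodw u := (\prod_(s <- u) val s)%g.
Local Notation len := (cox_length S).

Lemma artin_genE u :
  (\pi_(artin_group S) (pos_word u))%qT = (\prod_(s <- u) artin_gen s)%g.
Proof.
elim: u => [|s u IHu]; first by rewrite big_nil -pi_nil.
by rewrite big_cons -IHu -pi_cat.
Qed.

Lemma artin_braid s t m : has_order (val s * val t)%g m ->
  (\prod_(q <- alt s t m) artin_gen q = \prod_(q <- alt t s m) artin_gen q)%g.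
Proof.
move=> st_m; rewrite -!artin_genE; apply/eqP/pres_eqP/WordRel.
by exists s, t, m; split=> //; rewrite /pos_word /alt /alternating /mkseq -map_comp;
  apply: eq_map => i /=.
Qed.

Definition artin_lift w : artin_group S :=
  (\prod_(s <- sval (cid (reduced_word coxS w))) artin_gen s)%g.

Lemma artin_liftE u : reduced u ->
  artin_lift (prodw u) = (\prod_(s <- u) artin_gen s)%g.
Proof.
rewrite /artin_lift; case: cid => v [/= rv vu] ru.
by apply: (matsumoto coxS artin_braid) => //; rewrite (eqP rv) vu (eqP ru).
Qed.

Lemma artin_lift1 : artin_lift 1%g = 1%g.
Proof.
have := @artin_liftE [::]; rewrite !big_nil; apply.
by rewrite /reduced big_nil len1.
Qed.

Lemma artin_lift_mull s w : len (val s * w)%g = (len w).+1 ->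
  artin_lift (val s * w)%g = (artin_gen s * artin_lift w)%g.
Proof.
have [u [ru <-]] := reduced_word coxS w => su.
have suE : prodw (s :: u) = (val s * prodw u)%g by rewrite big_cons.
by rewrite -suE !artin_liftE ?big_cons //; apply: reduced_cons.
Qed.

Lemma artin_lift_mulr s w : len (w * val s)%g = (len w).+1 ->
  artin_lift (w * val s)%g = (artin_lift w * artin_gen s)%g.
Proof.
have [u [ru uw]] := reduced_word coxS w => su.
have usE : prodw (rcons u s) = (w * val s)%g.
  by rewrite -cats1 prodw_cat prodw1 uw.
rewrite -usE -uw !artin_liftE // /reduced ?size_rcons ?usE.
  by rewrite -cats1 big_cat big_seq1.
by rewrite (eqP ru) uw su.
Qed.

Lemma artin_gen_conj s t w : val t = (w * val s * w^-1)%g ->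
  exists g, artin_gen t = (g * artin_gen s * g^-1)%g.
Proof.
(* Both [w] and [w * val s] conjugate [val s] to [val t], and one of them is lengthened by [s] on
   the right. *)
wlog up : w / len (w * val s)%g = (len w).+1 => [IH tE|tE].
  case: (len_mulr coxS s w) => up; first exact: (IH w).
  apply: (IH (w * val s)%g); last by rewrite tE invgM !mulgA mulgK.
  by rewrite -mulgA gensK // mulg1.
have tw : (val t * w)%g = (w * val s)%g by rewrite tE mulgVK.
exists (artin_lift w).
rewrite -artin_lift_mulr // -tw artin_lift_mull ?mulgK //.
by rewrite tw.
Qed.
End ArtinLift.

(** * The twisted action *)

Section MalgExtension.
Variables (R : comNzRingType) (K : choiceType).
Implicit Types (M : lmodType R) (v : {malg R[K]}).

(** Counterpart of [grpalg_ext] for an arbitrary index type; the module of the theorem is indexed by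
    [option W]. *)
Definition malg_ext M (f : K -> M) v : M := \sum_(g <- msupp v) v@_g *: f g.

Lemma malg_extEw M (f : K -> M) v (d : {fset K}) :
  (msupp v `<=` d)%fset -> malg_ext f v = \sum_(g <- d) v@_g *: f g.
Proof.
move=> vd; apply: big_fset_incl => // g _ gv.
by rewrite (mcoeff_outdom gv) scale0r.
Qed.

Lemma malg_ext_linear M (f : K -> M) : linear (malg_ext f).
Proof.
move=> c x y.
rewrite !(@malg_extEw _ _ _ (msupp x `|` msupp y `|` msupp (c *: x + y))%fset).
- rewrite scaler_sumr -big_split; apply: eq_bigr => g _.
  by rewrite mcoeffD mcoeffZ scalerDl scalerA.
- by rewrite -fsetUA fsetUCA fsubsetUl.
- by rewrite -fsetUA fsubsetUl.
- exact: fsubsetUr.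
Qed.
HB.instance Definition _ M (f : K -> M) :=
  GRing.isLinear.Build R {malg R[K]} M _ (malg_ext f) (malg_ext_linear f).

Lemma malg_extU M (f : K -> M) g : malg_ext f << g >> = f g.
Proof.
rewrite (@malg_extEw _ _ _ [fset g]%fset) ?msuppU_le //.
by rewrite big_seq_fset1 mcoeffUU scale1r.
Qed.

Lemma malg_span_ind (p : {malg R[K]} -> Prop) (x0 : K) :
    (forall x, p << x >>) -> (forall c u v, p u -> p v -> p (c *: u + v)) ->
  forall v, p v.
Proof.
move=> pU pD v; rewrite [v]monalgE; apply: big_rec => [|x u _ pu].
  (* [p 0] is not assumed, so it is obtained from the basis vector at [x0]. *)
  by rewrite -[0](addNr << x0 >>) -scaleN1r; apply: pD; exact: pU.
have -> : << v@_x *g x >> = v@_x *: << x >> :> {malg R[K]}.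
  by apply/malgP => y; rewrite mcoeffZ !mcoeffU mulr_natr.
exact: pD.
Qed.
End MalgExtension.

(** * The coefficient ring *)

Section BaseRing.
Variable k : fieldType.

Lemma base_aa : base_a k * base_a k = 1.
Proof.
pose h : {poly k} := 'X^2 - 1.
(* [mk_monic] keeps its argument as the modulus only if this is monic and nonconstant. *)
have hE : mk_monic h = h by rewrite /mk_monic size_XnsubC // monicXnsubC.
have h0 : in_qpoly h h = 0.
  by apply: val_inj; rewrite /= hE Pdiv.RingMonic.rmodpp // monicXnsubC.
rewrite -[base_a k]/(in_qpoly h 'X) -in_qpolyM -expr2.
transitivity (in_qpoly h (h + 1)); first by rewrite /h subrK.
by rewrite in_qpolyD h0 add0r in_qpoly1.
Qed.

(** This is where the characteristic enters: [h] is the class of the constant polynomial 1/2. *)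
Lemma base_half : 2%N \notin [pchar k] -> exists h : base_ring k, h * 2%:R = 1.
Proof.
rewrite inE /= => two_neq0; pose h : {poly k} := 'X^2 - 1.
exists (in_qpoly h (2%:R^-1)%:P).
have -> : 2%:R = in_qpoly h 2%:R :> base_ring k by rewrite rmorph_nat.
by rewrite -[LHS]in_qpolyM -polyC_natr -polyCM mulVf // in_qpoly1.
Qed.
End BaseRing.

(** Meant for the operators of [s - a] and [t - a] with [s] and [t] conjugate in the Artin group,
    [u] being the operator of a conjugating element. *)
Lemma conj_sqr (T : pzRingType) (u u' x y : T) :
    u * u' = 1 -> u' * u = 1 -> y = u * x * u' -> u * (x * x) = x * x * u ->
  - (y * y) = - (x * x).
Proof.
move=> uu' u'u -> ux; rewrite -!mulrA (mulrA u' u) u'u mul1r.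
by rewrite (mulrA x x) (mulrA u) ux -(mulrA _ u) uu' mulr1.
Qed.

Section EndoLinear.
Variables (R : comNzRingType) (V : lmodType R).
Implicit Types u v : V.

Lemma endo_mapZ (f : endo V) c v : f (c *: v) = c *: f v.
Proof. exact: linearZ. Qed.

Lemma endo_mapD (f : endo V) u v : f (u + v) = f u + f v.
Proof. exact: linearD. Qed.

Lemma endo_mapN (f : endo V) v : f (- v) = - f v.
Proof. exact: linearN. Qed.

Lemma endo_oppE (f : endo V) v : (- f) v = - f v.
Proof. by []. Qed.

End EndoLinear.

Section RepAlgebra.
Variables (R : comNzRingType) (G : groupType) (V : lmodType R).
Variable rho : representation G V.
Implicit Types x y : grpalg R G.

Lemma repVK g v : rho g^-1%g (rho g v) = v.
Proof. by rewrite -endoME -repM mulVg rep1. Qed.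

Lemma rep_alg0 : rep_alg rho 0 = 0.
Proof. exact: linear0. Qed.

Lemma rep_algD x y : rep_alg rho (x + y) = rep_alg rho x + rep_alg rho y.
Proof. exact: linearD. Qed.

Lemma rep_algN x : rep_alg rho (- x) = - rep_alg rho x.
Proof. exact: linearN. Qed.

Lemma rep_algZ c x : rep_alg rho (c *: x) = c *: rep_alg rho x.
Proof. exact: linearZ. Qed.

Lemma rep_algM x y : rep_alg rho (x * y) = rep_alg rho x * rep_alg rho y.
Proof. exact: rmorphM. Qed.

Lemma rep_alg1 : rep_alg rho 1 = 1.
Proof. exact: rmorph1. Qed.
End RepAlgebra.

Section GenSub.
Variables (R : comNzRingType) (a : R) (W : groupType) (S : {pred W}).
Local Notation A := (grpalg R (artin_group S)).

(** The element [sub_a] over arbitrary coefficients; the construction below uses only [a * a = 1]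
    and a half of 1. *)
Definition gen_sub (s : gens S) : A := grpalg_of R (artin_gen s) - a *: (1 : A).

Variables (aa : a * a = 1) (V : lmodType R).
Variable rho : representation (artin_group S) V.

Lemma rep_alg_gen_sub s v :
  rep_alg rho (gen_sub s) v = rho (artin_gen s) v - a *: v.
Proof. by rewrite rep_algD rep_algN rep_algZ rep_algU rep_alg1. Qed.

Lemma gen_sub_sqE s v : rep_alg rho (- gen_sub s ^+ 2) v =
  - (rho (artin_gen s) (rho (artin_gen s) v)
     - (2%:R * a) *: rho (artin_gen s) v + v).
Proof.
rewrite expr2 rep_algN rep_algM endo_oppE; congr (- _).
rewrite endoME !rep_alg_gen_sub endo_mapD endo_mapN endo_mapZ.
rewrite scalerBr scalerA aa scale1r opprB addrA mulr_natl mulr2n scalerDl opprD.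
by rewrite addrAC [in RHS]addrA.
Qed.
End GenSub.

Section TwistedAction.
Variables (R : comNzRingType) (a h : R) (aa : a * a = 1) (h2 : h * 2%:R = 1).
Variables (W : groupType) (S : {pred W}) (coxS : coxeter_system S) (s0 : gens S).
Local Notation len := (cox_length S).
Local Notation B := (artin_group S).
Local Notation A := (grpalg R B).

Variables (V : lmodType R) (C : V) (E : W -> V).
Implicit Types (s t : gens S) (w : W) (b : bool) (v : V) (x y : A).

(** The second branch of the formulas, with [w'] standing for [s w] or, in the mirror image, for
    [w s]. *)
Definition down w w' : V :=
  - (2%:R * a ^+ len w) *: C + (2%:R * a) *: E w - E w'.

Variables (P : gens S -> bool -> endo V) (Q : gens S -> endo V).
(** With [lin_ext], this says that [C] and the [E w] form a basis of [V]: the first gives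
    generation, the second independence. *)
Hypothesis span_ind : forall p : V -> Prop, p C -> (forall w, p (E w)) ->
  (forall c u v, p u -> p v -> p (c *: u + v)) -> forall v, p v.
Hypothesis lin_ext : forall (M : lmodType R) (f : option W -> M),
  exists psi : {linear V -> M}, psi C = f None /\ forall w, psi (E w) = f (Some w).
(* [P s true] and [P s false] are the actions of s and of its inverse; the *)
(* analogous right operators Q commute with them.                          *)
Hypothesis PC : forall s b, P s b C = a *: C.
Hypothesis PE : forall s b w, P s b (E w) =
  if (len (val s * w)%g == (len w).+1) == b then E (val s * w)%g
  else down w (val s * w)%g.
Hypothesis QC : forall s, Q s C = a *: C.
Hypothesis QE : forall s w, Q s (E w) =
  if len (w * val s)%g == (len w).+1 then E (w * val s)%g
  else down w (w * val s)%g.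

Let endo_mapE := (endo_mapD, endo_mapN, endo_mapZ).

Lemma endo_eq (f g : endo V) :
  f C = g C -> (forall w, f (E w) = g (E w)) -> f = g.
Proof.
move=> fgC fgE; apply/endoP; apply: span_ind => // c u v fgu fgv.
by rewrite !endo_mapE fgu fgv.
Qed.

Lemma endo_down (f : endo V) w w' : f C = a *: C ->
  f (down w w') = - (2%:R * a ^+ (len w).+1) *: C + (2%:R * a) *: f (E w) - f (E w').
Proof. by move=> fC; rewrite /down !endo_mapE fC scalerA mulNr exprSr mulrA. Qed.

Lemma up_gen s w :
  (len (val s * (val s * w))%g == (len (val s * w)%g).+1) =
  ~~ (len (val s * w)%g == (len w).+1).
Proof.
rewrite gensMK //; case: (len_mull coxS s w) => e; rewrite e eqxx.
  by rewrite ltn_eqF // ltnS leqnSn.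
by rewrite [in RHS]ltn_eqF // ltnS leqnSn.
Qed.

Lemma aa_exp n : a ^+ n.+2 = a ^+ n.
Proof. by rewrite !exprS mulrA aa mul1r. Qed.

Lemma len_mull_exp s w : a ^+ len (val s * w)%g = a ^+ (len w).+1.
Proof. by case: (len_mull coxS s w) => ->; rewrite // aa_exp. Qed.

(** Of [E w] and [E (s w)], each operator merely moves one to the other and applies [down] to the
    second; the two operators have opposite roles. The terms in [C] cancel because the lengths of
    [s w] and [w] have opposite parity and [a * a = 1]. *)
Lemma PK s b : P s b * P s (~~ b) = 1.
Proof.
apply: endo_eq => [|w]; rewrite endoME endo1E.
  by rewrite PC endo_mapZ PC scalerA aa scale1r.
rewrite PE; case: ifPn => [up|]; first rewrite PE up_gen gensMK //.
  by rewrite (eqP up) negbK eqxx.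
move=> nup; have {nup} up : (len (val s * w)%g == (len w).+1) = b.
  by move: nup; case: (len _ == _); case: (b).
rewrite endo_down ?PC //.
rewrite !PE up_gen up eqxx gensMK // /down len_mull_exp.
by have -> : (~~ b == b) = false; [case: (b) | rewrite subKr].
Qed.

Lemma PE_up s w : len (val s * w)%g = (len w).+1 ->
  P s true (E w) = E (val s * w)%g.
Proof. by move=> up; rewrite PE up eqxx. Qed.

Lemma PE_down s w : len w = (len (val s * w)%g).+1 ->
  P s true (E w) = down w (val s * w)%g.
Proof. by move=> dn; rewrite PE dn ltn_eqF // ltnS leqnSn. Qed.

Lemma QE_up s w : len (w * val s)%g = (len w).+1 ->
  Q s (E w) = E (w * val s)%g.
Proof. by move=> up; rewrite QE up eqxx. Qed.

Lemma QE_down s w : len w = (len (w * val s)%g).+1 ->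
  Q s (E w) = down w (w * val s)%g.
Proof. by move=> dn; rewrite QE dn ltn_eqF // ltnS leqnSn. Qed.

Lemma PQ s t : P s true * Q t = Q t * P s true.
Proof.
apply: endo_eq => [|w]; rewrite !endoME.
  by rewrite QC PC !endo_mapZ QC PC.
have fold := folding coxS (s := s) (t := t) (w := w).
have assoc : (val s * (w * val t) = val s * w * val t)%g by rewrite mulgA.
have := len_mull coxS s (w * val t)%g; have := len_mulr coxS t (val s * w)%g.
rewrite assoc.
have [sw|sw] := len_mull coxS s w; have [wt|wt] := len_mulr coxS t w.
- rewrite (PE_up sw) (QE_up wt).
  move=> [tu|td] [su|sd].
  + by rewrite PE_up ?QE_up ?assoc.
  + by move: tu; rewrite sw -wt sd => /eqP; rewrite ltn_eqF // ltnS leqnSn.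
  + by move: su; rewrite wt -sw td => /eqP; rewrite ltn_eqF // ltnS leqnSn.
  (* Here [s w t] is as long as [w], so [folding] gives [s w = w t] and both sides are the same
     [down] term. *)
  + rewrite PE_down ?QE_down ?assoc // fold //; first by rewrite sw wt.
    by apply: succn_inj; rewrite -td sw.
- rewrite (PE_up sw) (QE_down wt) endo_down ?PC // (PE_up sw) => tD sD.
  have D : len (val s * w * val t)%g = len w.
    by move: tD sD; rewrite sw wt; lia.
  rewrite PE_up ?QE_down ?assoc ?D //.
  by rewrite /down sw.
- rewrite (PE_down sw) (QE_up wt) endo_down ?QC // (QE_up wt) => tD sD.
  have D : len (val s * w * val t)%g = len w.
    by move: tD sD; rewrite wt sw; lia.
  rewrite QE_up ?PE_down ?assoc ?D //.
  by rewrite /down wt.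
- rewrite (PE_down sw) (QE_down wt) !endo_down ?QC ?PC // (PE_down sw) (QE_down wt).
  have ll : len (val s * w)%g = len (w * val t)%g by apply: succn_inj; rewrite -sw.
  move=> [tu|td] [su|sd].
  + have e : (val s * w = w * val t)%g by apply: fold => //; rewrite tu.
    by rewrite PE_up ?QE_up ?assoc // e.
  + by move: tu; rewrite ll sd => /eqP; rewrite ltn_eqF // ltnS leqnSn.
  + by move: su; rewrite -ll td => /eqP; rewrite ltn_eqF // ltnS leqnSn.
  + rewrite PE_down ?QE_down ?assoc // /down ll.
    have swap (z1 z2 z3 c d : V) : z1 - z2 - (c + z3 - d) = z1 - z3 - (c + z2 - d).
      have e z' : - (c + z' - d) = - z' + (d - c).
        by rewrite opprB opprD addrA addrC.
      by rewrite !e addrACA.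
    by rewrite !scalerBr !addrA swap.
Qed.

Lemma PfalseQ s t : P s false * Q t = Q t * P s false.
Proof.
rewrite -[RHS]mul1r -(PK s false) -mulrA /= [in RHS](mulrA (P s true)) PQ.
by rewrite -!mulrA (PK s true) mulr1.
Qed.

Lemma PbQ s b t : P s b * Q t = Q t * P s b.
Proof. by case: b; [exact: PQ | exact: PfalseQ]. Qed.

(** * The action of the Artin group *)

Definition word_action (u : word (gens S)) : endo V := \prod_(i <- u) P i.1 i.2.

Lemma word_action_cat u u' :
  word_action (u ++ u') = word_action u * word_action u'.
Proof. exact: big_cat. Qed.

Lemma word_actionQ u t : word_action u * Q t = Q t * word_action u.
Proof.
rewrite /word_action; elim: u => [|i u IHu]; first by rewrite big_nil mul1r mulr1.
by rewrite big_cons -mulrA IHu !mulrA PbQ.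
Qed.

(* The right operators generate the module from the image of 1. *)
Lemma endo_eq1 (f g : endo V) :
    (forall t, f * Q t = Q t * f) -> (forall t, g * Q t = Q t * g) ->
  f (E 1%g) = g (E 1%g) -> f = g.
Proof.
move=> fQ gQ fg1.
have fgQ t v : f v = g v -> f (Q t v) = g (Q t v).
  by move=> fgv; rewrite -!endoME fQ gQ !endoME fgv.
have fgE w : f (E w) = g (E w).
  have [u [ru <-]] := reduced_word coxS w.
  elim/last_ind: u ru => [|u t IHu] rut; first by rewrite big_nil.
  have ru : reduced u by move: rut; rewrite -cats1; apply: reduced_catl.
  move: rut; rewrite /reduced -cats1 prodw_cat prodw1 size_cat addn1 => /eqP e.
  have up : len (\prod_(s <- u) val s * val t)%g = (len (\prod_(s <- u) val s)%g).+1.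
    by rewrite -e (eqP ru).
  by rewrite -(QE_up up); apply/fgQ/IHu.
apply: endo_eq => //; pose s := s0.
have s1 : len (1%g * val s)%g = (len (1%g : W)).+1.
  by case: (len_mulr coxS s 1%g) => //; rewrite len1.
(* Applying [Q s] twice to [E 1] gives [- 2a C + 2a E_s - E 1]; as [h a] is the inverse of [2a],
   this can be solved for [C]. *)
have CE : C = - (h * a) *: (Q s (Q s (E 1%g)) - (2%:R * a) *: E (1 * val s)%g + E 1%g).
  rewrite (QE_up s1) QE_down.
    have -> : (1 * val s * val s = 1)%g by rewrite -mulgA gensK // mulg1.
    rewrite /down s1 len1 expr1 addrAC subrK addrK scalerA mulrNN.
    by rewrite mulrACA h2 mul1r aa scale1r.
  by rewrite -mulgA gensK // mulg1 s1.
by rewrite CE !endo_mapE !fgE !fgQ.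
Qed.

Lemma word_action_pos u : reduced u ->
  word_action (pos_word u) (E 1%g) = E (\prod_(s <- u) val s)%g.
Proof.
elim: u => [|s u IHu] rsu; first by rewrite /word_action !big_nil.
have ru : reduced u := reduced_catr coxS (u := [:: s]) rsu.
rewrite /word_action big_cons endoME -/(word_action _) IHu // PE_up ?big_cons //.
by move: rsu; rewrite /reduced big_cons /= (eqP ru) => /eqP.
Qed.

(** Both sides of a braid relation commute with the [Q t], so they are compared at [E 1], which
    reduced words send to the basis vector of their product. *)
Lemma word_action_equiv u u' : word_equiv (@braid_rels W S) u u' ->
  word_action u = word_action u'.
Proof.
elim=> {u u'} // [u u' v _ -> _ -> //|u u' v v' _ IHu _ IHv|s b|u v].
- by rewrite !word_action_cat IHu IHv.
- by rewrite /word_action big_cons big_seq1 big_nil PK.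
case=> s [t [m [st_m -> ->]]].
have altE s' t' : alternating s' t' m = pos_word (alt s' t' m).
  by rewrite /pos_word /alt /alternating /mkseq -map_comp.
rewrite !altE; apply: endo_eq1; try exact: word_actionQ.
rewrite !word_action_pos ?(reduced_alt coxS _ (leqnn m)) //; last exact: has_orderC.
rewrite (prodw_alt coxS s t); case: st_m => _ /(_ m).
by rewrite dvdnn => /eqP ->; rewrite mul1g.
Qed.

Definition artin_action (g : B) : endo V := word_action (repr g).

Lemma artin_action_pi u : artin_action (\pi_B u)%qT = word_action u.
Proof. exact/word_action_equiv/repr_word_equiv. Qed.

Lemma artin_action1 : artin_action 1%g = 1.
Proof. by rewrite -pi_nil artin_action_pi /word_action big_nil. Qed.

Lemma artin_actionM g g' :
  artin_action (g * g')%g = artin_action g * artin_action g'.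
Proof.
elim/quotW: g => u; elim/quotW: g' => u'.
by rewrite -pi_cat !artin_action_pi word_action_cat.
Qed.

Definition artin_rep : representation B V :=
  Representation artin_action1 artin_actionM.
Local Notation rho := artin_rep.
Local Notation rhoA := (rep_alg artin_rep).

Lemma artin_rep_gen s : rho (artin_gen s) = P s true.
Proof.
by rewrite /= [LHS]artin_action_pi /word_action big_seq1.
Qed.

Lemma rep_algQ x t : rhoA x * Q t = Q t * rhoA x.
Proof.
elim/grpalg_ind: x => [|c g x IHx]; first by rewrite rep_alg0 mul0r mulr0.
rewrite rep_algD rep_algZ mulrDl mulrDr IHx rep_algU; congr (_ + _).
rewrite -endo_scalerAl -endo_scalerAr; congr (_ *: _).
exact: word_actionQ.
Qed.

Lemma rep_alg_eq x y : rhoA x (E 1%g) = rhoA y (E 1%g) -> rhoA x = rhoA y.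
Proof. by apply: endo_eq1 => t; exact: rep_algQ. Qed.

Lemma artin_rep_lift w : rho (artin_lift coxS w) (E 1%g) = E w.
Proof.
have [u [ru <-]] := reduced_word coxS w.
by rewrite artin_liftE // -artin_genE /= artin_action_pi word_action_pos.
Qed.

Lemma gen_sub_sq_rhoE s v : rhoA (- gen_sub a s ^+ 2) v =
  - (P s true (P s true v) - (2%:R * a) *: P s true v + v).
Proof. by rewrite (gen_sub_sqE aa artin_rep) artin_rep_gen. Qed.

Lemma Ctilde_C s : rhoA (- gen_sub a s ^+ 2) C = 0.
Proof.
rewrite gen_sub_sq_rhoE !PC endo_mapZ PC !scalerA aa scale1r -mulrA aa mulr1.
by rewrite addrAC -mulr2n scaler_nat subrr oppr0.
Qed.

Lemma Ctilde_E s w :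
  rhoA (- gen_sub a s ^+ 2) (E w) = (2%:R * a ^+ (len w).+1) *: C.
Proof.
rewrite gen_sub_sq_rhoE; suff -> : P s true (P s true (E w)) =
    - (2%:R * a ^+ (len w).+1) *: C + (2%:R * a) *: P s true (E w) - E w.
  by rewrite addrAC subrK addrK scaleNr opprK.
have [up|dn] := len_mull coxS s w.
  rewrite (PE_up up) PE_down ?gensMK ?up // /down.
  by rewrite up.
by rewrite {1}(PE_down dn) endo_down ?PC // [P s true (E (_ * _)%g)]PE_up ?gensMK.
Qed.

Lemma Ctilde_eq s t : rhoA (- gen_sub a s ^+ 2) = rhoA (- gen_sub a t ^+ 2).
Proof.
apply: endo_eq => [|w]; first exact: etrans (Ctilde_C s) (esym (Ctilde_C t)).
exact: etrans (Ctilde_E s w) (esym (Ctilde_E t w)).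
Qed.

(** * The two-sided ideal spanned by the operator of [-(s-a)^2] *)

Section RankOne.
Variable Z : endo V.
Hypothesis ZC : Z C = 0.
Hypothesis ZE : forall w, Z (E w) = (2%:R * a ^+ (len w).+1) *: C.

Lemma P_Ctilde s b : P s b * Z = a *: Z.
Proof.
apply: endo_eq => [|w]; rewrite endoME endoZE.
  by rewrite ZC scaler0; exact: linear0.
by rewrite ZE endo_mapZ PC !scalerA mulrC.
Qed.

Lemma Ctilde_P s b : Z * P s b = a *: Z.
Proof.
suff Zt : Z * P s true = a *: Z.
  (* [P s false] is the inverse of [P s true], and [a] is its own inverse. *)
  case: b => //; rewrite -[LHS]scale1r -aa -scalerA endo_scalerAl -Zt.
  by rewrite -mulrA (PK s true) mulr1.
apply: endo_eq => [|w]; rewrite endoME endoZE.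
  by rewrite PC endo_mapZ ZC scaler0.
have [up|dn] := len_mull coxS s w.
  by rewrite PE_up // !ZE up scalerA [in RHS]mulrCA -exprS.
rewrite (PE_down dn) /down !endo_mapE !ZE ZC scaler0 add0r scalerA.
by rewrite -scalerBl scalerA dn aa_exp; congr (_ *: _); rewrite !exprS; ring.
Qed.

Lemma rep_alg_Ctilde x :
  (exists c, rhoA x * Z = c *: Z) /\ (exists c, Z * rhoA x = c *: Z).
Proof.
have gen g : (exists c, rho g * Z = c *: Z) /\ (exists c, Z * rho g = c *: Z).
  elim/quotW: g => u /=; rewrite artin_action_pi.
  elim: u => [|[s b] u [[c IHc] [d IHd]]].
    rewrite /word_action big_nil mul1r mulr1.
    by split; exists 1; rewrite scale1r.
  rewrite /word_action big_cons -/(word_action u) /=; split.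
    exists (a * c); rewrite -mulrA IHc -endo_scalerAr P_Ctilde scalerA.
    by rewrite mulrC.
  by exists (a * d); rewrite mulrA Ctilde_P -endo_scalerAl IHd scalerA.
elim/grpalg_ind: x => [|e g x [[c IHc] [d IHd]]].
  by split; exists 0; rewrite rep_alg0 ?mul0r ?mulr0 scale0r.
have [[c' gc] [d' gd]] := gen g; rewrite rep_algD rep_algZ rep_algU; split.
  by exists (e * c' + c); rewrite mulrDl IHc -endo_scalerAl gc scalerA scalerDl.
by exists (e * d' + d); rewrite mulrDr IHd -endo_scalerAr gd scalerA scalerDl.
Qed.

(** The multiples of [Z] are stable under multiplication by the image on either side. This will
    bound the kernel of the projection to the Hecke algebra. *)
Lemma ideal_Ctilde (X : A -> Prop) x :
    (forall y, X y -> exists c, rhoA y = c *: Z) ->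
  grpalg_ideal X x -> exists c, rhoA x = c *: Z.
Proof.
move=> XZ; elim=> {x} [x /XZ //||x y _ [c xc] _ [d yd]|x y z _ [c yc]].
- by exists 0; rewrite rep_alg0 scale0r.
- by exists (c + d); rewrite rep_algD xc yd scalerDl.
- have [[[d xd] _] [_ [e ze]]] := (rep_alg_Ctilde x, rep_alg_Ctilde z).
  exists (c * d * e); rewrite !rep_algM yc -endo_scalerAr xd -!endo_scalerAl ze.
  by rewrite !scalerA.
Qed.
End RankOne.

(** * Intertwiners from the twisted module to other modules *)

Section Intertwiner.
Variables (M : lmodType R) (tau : representation B M) (c : endo M) (m1 : M).
Hypothesis sub_sqE : forall s, rep_alg tau (- gen_sub a s ^+ 2) = c.
Hypothesis gen_c : forall s, tau (artin_gen s) * c = a *: c.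
Hypothesis c_gen : forall s, c * tau (artin_gen s) = a *: c.

Section WithMap.
Variable psi : {linear V -> M}.
(** This value is forced: [-(s-a)^2] sends [E 1] to [2a C] and acts on [M] as [c], while [h a] is
    the inverse of [2a]. *)
Hypothesis psiC : psi C = (h * a) *: c m1.
Hypothesis psiE : forall w, psi (E w) = tau (artin_lift coxS w) m1.

Lemma gen_sq s m : tau (artin_gen s) (tau (artin_gen s) m) =
  (2%:R * a) *: tau (artin_gen s) m - m - c m.
Proof.
rewrite -(sub_sqE s) gen_sub_sqE // opprK.
set x := _ *: _; set y := tau _ _.
by rewrite [RHS]addrC addrA addrAC addrK subrK.
Qed.

Lemma c_lift w : c (tau (artin_lift coxS w) m1) = a ^+ len w *: c m1.
Proof.
have [u [ru <-]] := reduced_word coxS w; rewrite artin_liftE // -(eqP ru).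
elim: u {ru} => [|s u IHu]; first by rewrite big_nil rep1 endo1E scale1r.
by rewrite big_cons repM endoME -(endoME c) c_gen endoZE IHu scalerA -exprS.
Qed.

(** For a descent the lift of [w] is [s] times that of [s w], so [gen_sq] applies. Its last term is
    a power of [a] times [c m1] by [c_lift], which matches the coefficient of [C] in [down]. *)
Lemma psi_gen s v : psi (P s true v) = tau (artin_gen s) (psi v).
Proof.
elim/span_ind: v => [|w|d u v IHu IHv].
- rewrite PC linearZ /= psiC endo_mapZ -endoME gen_c endoZE.
  by rewrite !scalerA mulrC.
- have [up|dn] := len_mull coxS s w.
    by rewrite PE_up // !psiE -endoME -repM artin_lift_mull.
  have liftE : artin_lift coxS w = (artin_gen s * artin_lift coxS (val s * w))%g.
    by rewrite -artin_lift_mull ?gensMK.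
  rewrite (PE_down dn) /down !linearD !linearN !linearZ /= psiC !psiE.
  rewrite liftE repM endoME gen_sq c_lift -addrA addrC; congr (_ + _).
  rewrite scaleNr scalerA dn exprS; congr (- (_ *: _)).
  transitivity (h * 2%:R * (a * a) * a ^+ len (val s * w)%g); first by ring.
  by rewrite h2 aa !mul1r.
- by rewrite !endo_mapD !endo_mapZ !linearP /= IHu IHv.
Qed.

Lemma psi_rho g v : psi (rho g v) = tau g (psi v).
Proof.
elim/quotW: g => u /=; rewrite artin_action_pi.
elim: u v => [|[s b] u IHu] v.
  by rewrite /word_action big_nil endo1E pi_nil rep1 endo1E.
rewrite /word_action big_cons -/(word_action u) endoME -cat1s pi_cat repM.
rewrite endoME -IHu /=; case: b; first exact: psi_gen.
rewrite pi_inv_gen -{2}[word_action u v](endo1E) -(PK s true) endoME psi_gen.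
by rewrite repVK.
Qed.

Lemma psi_rep_alg x v : psi (rhoA x v) = rep_alg tau x (psi v).
Proof.
elim/grpalg_ind: x => [|d g x IHx]; first by rewrite !rep_alg0; exact: linear0.
by rewrite !rep_algD !rep_algZ !rep_algU !endoDE !endoZE linearP /= IHx psi_rho.
Qed.

End WithMap.

Lemma rep_alg_ker x : rhoA x = 0 -> rep_alg tau x m1 = 0.
Proof.
move=> x0; have [psi [psiC psiE]] := lin_ext (fun o =>
  if o is Some w then tau (artin_lift coxS w) m1 else (h * a) *: c m1).
have := psi_rep_alg psiC psiE x (E 1%g).
by rewrite psiE artin_lift1 rep1 endo1E => <-; rewrite x0; exact: linear0.
Qed.
End Intertwiner.

(** * Modules satisfying the Hecke or the cubic relations *)

Section Presentations.
Variables (M : lmodType R) (tau : representation B M).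
Local Notation D s := (rep_alg tau (gen_sub a s)).

Lemma rep_gen_sub s : tau (artin_gen s) = D s + a *: (1 : endo M).
Proof.
by apply/endoP => m; rewrite endoDE endoZE endo1E rep_alg_gen_sub subrK.
Qed.

Lemma rep_genM s (n : endo M) : D s * n = 0 -> tau (artin_gen s) * n = a *: n.
Proof.
by move=> sn; rewrite rep_gen_sub mulrDl sn add0r -endo_scalerAl mul1r.
Qed.

Lemma rep_Mgen s (n : endo M) : n * D s = 0 -> n * tau (artin_gen s) = a *: n.
Proof.
by move=> sn; rewrite rep_gen_sub mulrDr sn add0r -endo_scalerAr mulr1.
Qed.

Lemma rep_sub_sq s : rep_alg tau (- gen_sub a s ^+ 2) = - (D s * D s).
Proof. by rewrite expr2 rep_algN rep_algM. Qed.

(** The Hecke relations are the case [c = 0] of the intertwiner. *)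
Lemma hecke_ker m x : (forall s, rep_alg tau (gen_sub a s ^+ 2) = 0) ->
  rhoA x = 0 -> rep_alg tau x m = 0.
Proof.
move=> sq0; apply: (rep_alg_ker (c := 0)) => s.
- by rewrite rep_algN sq0 oppr0.
- by rewrite mulr0 scaler0.
- by rewrite mul0r scaler0.
Qed.

Lemma rep_comm_gens (n : endo M) :
    (forall s, tau (artin_gen s) * n = n * tau (artin_gen s)) ->
  forall g, tau g * n = n * tau g.
Proof.
move=> n_comm; elim/quotW=> u; elim: u => [|[s b] u IHu].
  by rewrite pi_nil rep1 mul1r mulr1.
rewrite -cat1s pi_cat repM -mulrA IHu !mulrA; congr (_ * _).
case: b; first exact: n_comm.
rewrite pi_inv_gen; set g := artin_gen s; have gV : tau g * tau g^-1%g = 1.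
  by rewrite -repM mulgV rep1.
have Vg : tau g^-1%g * tau g = 1 by rewrite -repM mulVg rep1.
by rewrite -[LHS]mulr1 -gV mulrA -(mulrA _ n) -n_comm mulrA Vg mul1r.
Qed.

Lemma cubic_ker m x : single_reflection_class S ->
    (forall s t, rep_alg tau (gen_sub a t * gen_sub a s ^+ 2) = 0) ->
    (forall s t, rep_alg tau (gen_sub a s ^+ 2 * gen_sub a t) = 0) ->
  rhoA x = 0 -> rep_alg tau x m = 0.
Proof.
move=> one_class DDD DDD'.
have ts s t : tau (artin_gen t) * (D s * D s) = a *: (D s * D s).
  by apply: rep_genM; have := DDD s t; rewrite expr2 !rep_algM.
have st s t : D s * D s * tau (artin_gen t) = a *: (D s * D s).
  by apply: rep_Mgen; have := DDD' s t; rewrite expr2 !rep_algM.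
(* The lifts of [s] and [s0] are conjugate by some [g], and [g] commutes with the square
   [D s0 * D s0] because every generator multiplies it by [a] on both sides. *)
have DE s : - (D s * D s) = - (D s0 * D s0).
  have reflS t : reflection S (val t).
    by exists t, 1%g; rewrite invg1 mul1g mulg1.
  have [w sE] := one_class _ _ (reflS s0) (reflS s).
  have [g gE] := artin_gen_conj coxS sE.
  have Vg : tau g^-1%g * tau g = 1 by rewrite -repM mulVg rep1.
  have gV : tau g * tau g^-1%g = 1 by rewrite -repM mulgV rep1.
  apply: (conj_sqr gV Vg).
    apply: (addIr (a *: (1 : endo M))); rewrite -rep_gen_sub gE !repM rep_gen_sub.
    rewrite mulrDr mulrDl; congr (_ + _).
    by rewrite -endo_scalerAr -endo_scalerAl mulr1 gV.
  by apply: rep_comm_gens => t; rewrite ts st.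
apply: (rep_alg_ker (c := - (D s0 * D s0))) => s.
- exact (etrans (rep_sub_sq s) (DE s)).
- by rewrite mulrN ts scalerN.
- by rewrite mulNr st scalerN.
Qed.
End Presentations.

(** Gathers what the theorem needs about the action, [z] being the common operator of the
    [-(s-a)^2]. The clauses on [tau] are meant for the regular modules of the two quotients. *)
Lemma twisted_rep : exists (rho : representation B V) (z : endo V),
  [/\ forall s, rho (artin_gen s) = P s true,
      forall x y, rep_alg rho x (E 1%g) = rep_alg rho y (E 1%g) ->
        rep_alg rho x = rep_alg rho y
    & forall v, exists x, rep_alg rho x (E 1%g) = v] /\
  [/\ forall s, rep_alg rho (- gen_sub a s ^+ 2) = z,
      forall s t, rep_alg rho (gen_sub a t * gen_sub a s ^+ 2) = 0,
      forall s t, rep_alg rho (gen_sub a s ^+ 2 * gen_sub a t) = 0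
    & forall (X : A -> Prop) x,
        (forall y, X y -> exists c, rep_alg rho y = c *: z) ->
        grpalg_ideal X x -> exists c, rep_alg rho x = c *: z] /\
  (forall x, rep_alg rho x = 0 ->
     forall (M : lmodType R) (tau : representation B M) m,
       (forall s, rep_alg tau (gen_sub a s ^+ 2) = 0) -> rep_alg tau x m = 0) /\
  (forall x, rep_alg rho x = 0 -> single_reflection_class S ->
     forall (M : lmodType R) (tau : representation B M) m,
       (forall s t, rep_alg tau (gen_sub a t * gen_sub a s ^+ 2) = 0) ->
       (forall s t, rep_alg tau (gen_sub a s ^+ 2 * gen_sub a t) = 0) ->
     rep_alg tau x m = 0).
Proof.
pose z := rhoA (- gen_sub a s0 ^+ 2).
have zs s : rhoA (- gen_sub a s ^+ 2) = z := Ctilde_eq s s0.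
have zC : z C = 0 := Ctilde_C s0.
have zE w : z (E w) = (2%:R * a ^+ (len w).+1) *: C := Ctilde_E s0 w.
have sq s : rhoA (gen_sub a s ^+ 2) = - z by rewrite -(zs s) rep_algN opprK.
have Dz s : rhoA (gen_sub a s) * z = 0.
  have := P_Ctilde zC zE s true; rewrite -artin_rep_gen rep_gen_sub mulrDl.
  rewrite -endo_scalerAl mul1r -[RHS]add0r; exact: addIr.
have zD s : z * rhoA (gen_sub a s) = 0.
  have := Ctilde_P zC zE s true; rewrite -artin_rep_gen rep_gen_sub mulrDr.
  rewrite -endo_scalerAr mulr1 -[RHS]add0r; exact: addIr.
exists rho, z; split; [split | split; [split | split]] => //.
- exact: artin_rep_gen.
- exact: rep_alg_eq.
- elim/span_ind => [|w|c u v [x <-] [y <-]].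
  (* The element [-(s0-a)^2] sends [E 1] to [2a C], whence the factor [h a]. *)
  + exists ((h * a) *: (- gen_sub a s0 ^+ 2)).
    rewrite rep_algZ endoZE Ctilde_E len1 expr1 scalerA.
    by rewrite mulrACA h2 mul1r aa scale1r.
  + by exists (grpalg_of R (artin_lift coxS w)); rewrite rep_algU artin_rep_lift.
  + by exists (c *: x + y); rewrite rep_algD rep_algZ endoDE endoZE.
- by move=> s t; rewrite rep_algM sq mulrN Dz oppr0.
- by move=> s t; rewrite rep_algM sq mulNr zD oppr0.
- by move=> X x; exact: ideal_Ctilde.
- by move=> x x0 M tau m sq0; exact (hecke_ker m sq0 x0).
- by move=> x x0 one M tau m tD Dt; exact (cubic_ker m one tD Dt x0).
Qed.
End TwistedAction.

(** * Quotients of the group algebra *)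

Section Freeness.
Variable R : comNzRingType.

Lemma malg_free (K : choiceType) n (e : 'I_n -> K) : bijective e ->
  free_of_rank {malg R[K]} n.
Proof.
case=> e' eK e'K.
pose f (r : 'rV[R]_n) : {malg R[K]} := \sum_i r 0 i *: << e i >>.
have f_lin : linear f.
  move=> c r r'; rewrite /f scaler_sumr -big_split; apply: eq_bigr => i _ /=.
  by rewrite !mxE scalerDl scalerA.
have fE r x : (f r)@_x = r 0 (e' x).
  rewrite /f raddf_sum (bigD1 (e' x)) //= big1 => [|i ne].
    by rewrite mcoeffZ mcoeffU e'K eqxx mulr1 addr0.
  by rewrite mcoeffZ mcoeffU (can2_eq eK e'K) (negPf ne) mulr0.
pose F : {linear 'rV[R]_n -> {malg R[K]}} :=
  HB.pack f (GRing.isLinear.Build R _ _ _ f f_lin).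
exists F.
exists (fun v => \row_i v@_(e i)) => [r|v] /=.
  by apply/rowP => i; rewrite mxE fE eK.
by apply/malgP => x; rewrite fE mxE e'K.
Qed.

Lemma free_of_rank_iso (V M : lmodType R) (ev : M -> V) n : linear ev ->
    injective ev -> (forall v, exists z, ev z = v) ->
  free_of_rank V n -> free_of_rank M n.
Proof.
move=> ev_lin ev_inj ev_surj [f [f' fK f'K]].
pose g r := sval (cid (ev_surj (f r))).
have gE r : ev (g r) = f r by rewrite /g; case: cid.
have g_lin : linear g by move=> c r r'; apply: ev_inj; rewrite ev_lin !gE linearP.
pose F : {linear 'rV[R]_n -> M} :=
  HB.pack g (GRing.isLinear.Build R _ _ _ g g_lin).
exists F.
exists (fun z => f' (ev z)) => [r|z] /=; first by rewrite gE fK.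
by apply: ev_inj; rewrite gE f'K.
Qed.
End Freeness.

(** * Regular modules of the quotients *)

Section RegularRepresentation.
Variables (R : comNzRingType) (G : groupType) (X : grpalg R G -> Prop).
Local Notation pr := (grpalg_proj X).

Lemma projD x y : pr (x + y) = pr x + pr y.
Proof. exact: raddfD. Qed.

Lemma projM x y : pr (x * y) = pr x * pr y.
Proof. exact: rmorphM. Qed.

Lemma projZ c x : pr (c *: x) = c *: pr x.
Proof. exact: linearZ. Qed.

Lemma regular_linear (x : grpalg R G) :
  linear (fun y : grpalg_quot X => pr x * y : grpalg_quot X).
Proof.
move=> c; elim/grpalg_quotP=> y; elim/grpalg_quotP=> y'.
rewrite -linearP -!rmorphM -linearP; congr (pr _).
by rewrite mulrDr grpalg_scalerAr.
Qed.

Definition regular (g : G) : endo (grpalg_quot X) :=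
  Endo (introT (asboolP _) (regular_linear (grpalg_of R g))).

Lemma regular1 : regular 1%g = 1.
Proof. by apply/endoP => y; rewrite /= grpalg_of1 rmorph1 mul1r. Qed.

Lemma regularM g g' : regular (g * g')%g = regular g * regular g'.
Proof. by apply/endoP => y; rewrite /= grpalg_ofM rmorphM -mulrA. Qed.

(** Acting on 1 in this module returns the class in the quotient, so an element that annihilates the
    module vanishes there. *)
Definition regular_rep : representation G (grpalg_quot X) :=
  Representation regular1 regularM.

Lemma regular_repE x y : rep_alg regular_rep x y = pr x * y.
Proof.
elim/grpalg_ind: x => [|c g x IHx]; first by rewrite rep_alg0 raddf0 mul0r.
rewrite rep_algD rep_algZ rep_algU endoDE endoZE IHx /= projD mulrDl.
congr (_ + _); elim/grpalg_quotP: y {IHx} => y.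
by rewrite projZ -projM -!projZ -projM grpalg_scalerAl.
Qed.

Lemma regular_rep_rel x : X x -> rep_alg regular_rep x = 0.
Proof.
move=> Xx; apply/endoP => y; rewrite regular_repE.
suff -> : pr x = 0 by rewrite mul0r.
by rewrite -(raddf0 pr); apply/grpalg_projP; rewrite subr0; apply: IdealGen.
Qed.
End RegularRepresentation.

(** * Maps between the image and the quotients *)

Section Factorization.
Variables (R : comNzRingType) (G : groupType) (V : lmodType R).
Variables (rho : representation G V) (X : grpalg R G -> Prop).
Local Notation pr := (grpalg_proj X).

Lemma to_imageP (z : image_alg rho) : exists x, to_image rho x = z.
Proof. by have /asboolP[x zx] := valP z; exists x; apply: val_inj. Qed.

Lemma to_image_eq x y : rep_alg rho x = rep_alg rho y ->
  to_image rho x = to_image rho y.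
Proof. by move=> xy; apply: val_inj. Qed.

Lemma image_to_quot : (forall x, rep_alg rho x = 0 -> pr x = 0) ->
  exists p : {rmorphism image_alg rho -> grpalg_quot X},
    scalable p /\ forall x, p (to_image rho x) = pr x.
Proof.
move=> ker; pose p z := pr (sval (cid (to_imageP z))).
have pE x : p (to_image rho x) = pr x.
  rewrite /p; case: cid => y /= /(congr1 val) /= yx; apply/eqP.
  by rewrite -subr_eq0 -raddfB; apply/eqP/ker; rewrite raddfB /= yx subrr.
have p_zmod : zmod_morphism p.
  move=> z z'; have [x <-] := to_imageP z; have [x' <-] := to_imageP z'.
  by rewrite -raddfB !pE raddfB.
have p_mul : monoid_morphism p.
  split=> [|z z']; first by rewrite -(rmorph1 (to_image rho)) pE rmorph1.
  have [x <-] := to_imageP z; have [x' <-] := to_imageP z'.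
  by rewrite -rmorphM !pE rmorphM.
pose F : {rmorphism image_alg rho -> grpalg_quot X} :=
  HB.pack p (GRing.isZmodMorphism.Build _ _ p p_zmod)
            (GRing.isMonoidMorphism.Build _ _ p p_mul).
exists F.
split=> [c z|x] /=; last exact: pE.
by have [x <-] := to_imageP z; rewrite -linearZ !pE linearZ.
Qed.

Lemma quot_to_image : (forall x, X x -> rep_alg rho x = 0) ->
  exists f : {rmorphism grpalg_quot X -> image_alg rho},
    scalable f /\ forall x, f (pr x) = to_image rho x.
Proof.
move=> rel0; pose f (q : grpalg_quot X) := to_image rho (grpalg_repr q).
have J0 x : grpalg_ideal X x -> rep_alg rho x = 0.
  elim=> {x} [x /rel0 //||x y _ x0 _ y0|x y z _ y0].
  - exact: rep_alg0.
  - by rewrite rep_algD x0 y0 addr0.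
  - by rewrite !rep_algM y0 mulr0 mul0r.
have fE x : f (pr x) = to_image rho x.
  apply: to_image_eq; apply/eqP; rewrite -subr_eq0 -rep_algN -rep_algD.
  exact/eqP/J0/repr_proj.
have f_zmod : zmod_morphism f.
  elim/grpalg_quotP=> x; elim/grpalg_quotP=> y.
  by rewrite -raddfB !fE raddfB.
have f_mul : monoid_morphism f.
  split=> [|]; first by rewrite -(rmorph1 pr) fE rmorph1.
  elim/grpalg_quotP=> x; elim/grpalg_quotP=> y.
  by rewrite -rmorphM !fE rmorphM.
pose F : {rmorphism grpalg_quot X -> image_alg rho} :=
  HB.pack f (GRing.isZmodMorphism.Build _ _ f f_zmod)
            (GRing.isMonoidMorphism.Build _ _ f f_mul).
exists F.
split=> [c|x] /=; last exact: fE.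
by elim/grpalg_quotP=> x; rewrite -linearZ !fE linearZ.
Qed.
End Factorization.

Section ExtensionRepresentation.
Variables (k : fieldType) (W : groupType) (S : {pred W}).
Local Notation R := (base_ring k).
Local Notation a := (base_a k).
Local Notation V := (ext_module k W).
Local Notation C := (basisC k W).
Local Notation E := (@basisE k W).
Local Notation len := (cox_length S).
Local Notation B := (artin_group S).
Local Notation A := (grpalg R B).

Definition endo_of (f : option W -> V) : endo V :=
  Endo (introT (asboolP _) (malg_ext_linear f)).

Definition left_op (s : gens S) b : endo V := endo_of (fun o =>
  if o is Some w then
    if (len (val s * w)%g == (len w).+1) == b then E (val s * w)%g
    else down a S C E w (val s * w)%g
  else a *: C).

Definition right_op (s : gens S) : endo V := endo_of (fun o =>
  if o is Some w then
    if len (w * val s)%g == (len w).+1 then E (w * val s)%g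
    else down a S C E w (w * val s)%g
  else a *: C).

Lemma ext_twisted_rep : 2%N \notin [pchar k] -> coxeter_system S -> gens S ->
  exists (rho : representation B V) (z : endo V),
  [/\ forall s, rho (artin_gen s) = left_op s true,
      forall x y, rep_alg rho x (E 1%g) = rep_alg rho y (E 1%g) ->
        rep_alg rho x = rep_alg rho y
    & forall v, exists x, rep_alg rho x (E 1%g) = v] /\
  [/\ forall s, rep_alg rho (- gen_sub a s ^+ 2) = z,
      forall s t, rep_alg rho (gen_sub a t * gen_sub a s ^+ 2) = 0,
      forall s t, rep_alg rho (gen_sub a s ^+ 2 * gen_sub a t) = 0
    & forall (X : A -> Prop) x,
        (forall y, X y -> exists c, rep_alg rho y = c *: z) ->
        grpalg_ideal X x -> exists c, rep_alg rho x = c *: z] /\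
  (forall x, rep_alg rho x = 0 ->
     forall (M : lmodType R) (tau : representation B M) m,
       (forall s, rep_alg tau (gen_sub a s ^+ 2) = 0) -> rep_alg tau x m = 0) /\
  (forall x, rep_alg rho x = 0 -> single_reflection_class S ->
     forall (M : lmodType R) (tau : representation B M) m,
       (forall s t, rep_alg tau (gen_sub a t * gen_sub a s ^+ 2) = 0) ->
       (forall s t, rep_alg tau (gen_sub a s ^+ 2 * gen_sub a t) = 0) ->
     rep_alg tau x m = 0).
Proof.
move=> char_k coxS s0; have [h h2] := base_half char_k.
apply: (twisted_rep (base_aa k) h2 coxS s0 (V := V) (C := C) (E := E)
          (P := left_op) (Q := right_op)) => [p pC pE pD|M f|s b|s b w|s|s w].
- by apply: (malg_span_ind None) => // -[w|]; [exact: pE|exact: pC].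
- by exists (malg_ext f); split=> [|w]; exact: malg_extU.
- exact: (malg_extU _ None).
- exact: (malg_extU _ (Some w)).
- exact: (malg_extU _ None).
- exact: (malg_extU _ (Some w)).
Qed.
End ExtensionRepresentation.

Theorem theorem6p22 (k : fieldType) (W : groupType) (S : {pred W})
    (char_k : 2%N \notin [pchar k]) (coxS : coxeter_system S)
    (S_neq0 : exists s : W, s \in S) :
  exists rho : representation (artin_group S) (ext_module k W),
    ext_formulas rho /\
    (forall (n : nat) (e : 'I_n -> W), bijective e ->
       free_of_rank (image_alg rho) (1 + n)) /\
    (forall s t : gens S,
       to_image rho (Ctilde k s) = to_image rho (Ctilde k t)) /\
    (exists p : {rmorphism image_alg rho -> grpalg_quot (@hecke_rels k W S)},
       [/\ scalable p,
           forall x : grpalg (base_ring k) (artin_group S),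
             p (to_image rho x) = grpalg_proj (@hecke_rels k W S) x,
           forall y, exists z, p z = y
         & forall (s : gens S) (z : image_alg rho),
             p z = 0 <-> exists c, z = c *: to_image rho (Ctilde k s)]) /\
    (single_reflection_class S ->
       exists f : {rmorphism grpalg_quot (@cubic_rels k W S)
                             -> image_alg rho},
         [/\ scalable f,
             forall x : grpalg (base_ring k) (artin_group S),
               f (grpalg_proj (@cubic_rels k W S) x) = to_image rho x
           & bijective f]).
Proof.
have [s0 s0S] := S_neq0; pose g0 : gens S := exist _ s0 s0S.
have [rho [z [[rho_gen ev_inj ev_surj] [rho_z [ker_hecke ker_cubic]]]]] :=
  ext_twisted_rep char_k coxS g0.
have [rho_sq rho_l rho_r ideal_z] := rho_z; exists rho.
have CtildeE s : Ctilde k s = - gen_sub (base_a k) s ^+ 2 by [].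
have zE s : rep_alg rho (Ctilde k s) = z by rewrite CtildeE.
split; [|split; [|split; [|split]]].
- move=> s; rewrite rho_gen; split; first exact: (malg_extU _ None).
  by move=> w /=; rewrite [LHS](malg_extU _ (Some w)) eqb_id.
- move=> n e e_bij.
  (* Evaluation at [E 1] identifies the image with the whole module. *)
  apply: (@free_of_rank_iso _ (ext_module k W) _
    (fun f : image_alg rho => val f (basisE k 1%g))) => [c f g|f g|v|].
  + by [].
  + have [x <-] := to_imageP f; have [y <-] := to_imageP g.
    by move=> /ev_inj; exact: to_image_eq.
  + by have [x xv] := ev_surj v; exists (to_image rho x).
  + case: e_bij => e' eK e'K.
    (* The index 0 stands for [C], and the other [n] indices enumerate [W] through [e]. *)
    apply: (@malg_free _ _ _ (fun i : 'I_(1 + n) => omap e (unlift ord0 i))).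
    exists (fun o => if o is Some w then lift ord0 (e' w) else ord0).
      by move=> i; case: unliftP => [j ->|->] //=; rewrite eK.
    by case=> [w|]; rewrite ?liftK ?unlift_none //= e'K.
- by move=> s t; apply: to_image_eq; exact (etrans (zE s) (esym (zE t))).
- have ker x : rep_alg rho x = 0 -> grpalg_proj (@hecke_rels k W S) x = 0.
    move=> x0; rewrite -[LHS]mulr1 -regular_repE; apply: ker_hecke => // s.
    by apply: regular_rep_rel; exists s.
  have [p [pZ pE]] := image_to_quot ker; exists p; split=> // [y|s u].
    by exists (to_image rho (grpalg_repr y)); rewrite pE grpalg_reprK.
  split=> [|[c ->]].
    have [x <-] := to_imageP u; rewrite pE => x0.
    (* An element of the Hecke ideal acts as a multiple of [z], since each generator [(s-a)^2] acts
       as [-z]. *)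
    have /ideal_z xz : grpalg_ideal (@hecke_rels k W S) x.
      by rewrite -[x]subr0; apply/grpalg_projP; rewrite x0 raddf0.
    have [_ [s' ->]|c xc] := xz.
      by exists (-1); rewrite -(rho_sq s') rep_algN scaleN1r opprK.
    by exists c; apply: val_inj; rewrite /= xc -(rho_sq s).
  rewrite pZ pE; suff -> : grpalg_proj (@hecke_rels k W S) (Ctilde k s) = 0.
    exact: scaler0.
  rewrite -(raddf0 (grpalg_proj (@hecke_rels k W S))).
  apply/grpalg_projP; rewrite subr0; apply/grpalg_idealN/IdealGen.
  by exists s.
move=> one_class.
have rel0 x : @cubic_rels k W S x -> rep_alg rho x = 0.
  by case=> s [t [->|->]]; [exact: rho_l|exact: rho_r].
have [f [fZ fE]] := quot_to_image rel0; exists f; split=> //.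
have f_inj : injective f.
  move=> q q'; rewrite -(grpalg_reprK q) -(grpalg_reprK q') !fE.
  move=> /(congr1 val) /= e; apply/grpalg_projP.
  set x := grpalg_repr q - grpalg_repr q'.
  rewrite -[x]subr0; apply/grpalg_projP; rewrite raddf0.
  (* The class of [x] is its action on 1 in the regular module of the cubic quotient, and [x] acts
     as zero under [rho]. *)
  rewrite -[LHS]mulr1 -regular_repE; apply: ker_cubic => // [|s t|s t].
  - by rewrite rep_algD rep_algN e subrr.
  - by apply: regular_rep_rel; exists s, t; left.
  - by apply: regular_rep_rel; exists s, t; right.
have inv u : exists q, f q = u.
  by have [x <-] := to_imageP u; exists (grpalg_proj _ x).
exists (fun u => sval (cid (inv u))) => [q|u]; last by case: cid.
by apply: f_inj; case: cid.
Qed.
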